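(* Let $\boldsymbol{n}=(n_1,\dots,n_r)$ and $\boldsymbol{d}=(d_1,\dots,d_r)$ be $r$-tuples of positive integers with $n_1\le\dots\le n_r$ and $d_1+\dots+d_r\ge3$. Let $SV^{\boldsymbol{n}}_{\boldsymbol{d}}\subset\mathbb{P}^N$ be the corresponding Segre-Veronese variety and let $p_0,\dots,p_{n_1}\in SV^{\boldsymbol{n}}_{\boldsymbol{d}}$ be general points. If $d:=\min\{d_1,\dots,d_r\}\ge2$, then a general hyperplane $H\subset\mathbb{P}^N$ containing $$T=\langle T^{d-1}_{p_0}SV^{\boldsymbol{n}}_{\boldsymbol{d}},\dots,T^{d-1}_{p_{n_1}}SV^{\boldsymbol{n}}_{\boldsymbol{d}}\rangle$$ is not tangent to $SV^{\boldsymbol{n}}_{\boldsymbol{d}}$ along a positive dimensional subvariety.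
   Context: We work over the complex numbers. **Segre-Veronese variety.** $SV^{\boldsymbol{n}}_{\boldsymbol{d}}\subset\mathbb{P}^{N}$, with $N=\prod_{i=1}^r\binom{n_i+d_i}{d_i}-1$, is the product $\mathbb{P}^{n_1}\times\dots\times\mathbb{P}^{n_r}$ embedded by the complete linear system $|\mathcal{O}_{\mathbb{P}^{n_1}\times\dots\times\mathbb{P}^{n_r}}(d_1,\dots,d_r)|$. **Osculating spaces.** Let $X\subset\mathbb{P}^N$ be a projective variety of dimension $n$, $p\in X$ a smooth point, and $\phi:\mathcal{U}\subseteq\mathbb{C}^n\to\mathbb{C}^N$ a local parametrization of $X$ near $p$ with $\phi(0)=p$. The $s$-osculating space $T^s_pX$ is the projective closure in $\mathbb{P}^N$ of the affine subspace of $\mathbb{C}^N$ through $p$ whose direction is generated by all partial derivatives of $\phi$ at $0$ of order at most $s$. A hyperplane $H$ is tangent to $X$ at a (smooth) point $x$ if $T_xX\subset H$. *)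

(* Defs.v *)
From HB Require Import structures.
From mathcomp Require Import all_boot all_order all_algebra.
From mathcomp Require Import mpoly.
From mathcomp Require Import complex reals.

Set Implicit Arguments.
Unset Strict Implicit.
Unset Printing Implicit Defensive.

Import Order.TTheory GRing.Theory Num.Theory.
Local Open Scope ring_scope.

(** * Zariski topology of products of projective spaces

  A product of projective spaces over [F] is given by its finite set [V] of
  homogeneous coordinates and a map [b : V -> K] assigning to each coordinate
  the factor it belongs to:
  - [b := fun=> tt] gives one projective space P^(#|V| - 1);
  - [b := fst] on ['I_m * V] gives the m-th power of that space.
  Points are given by homogeneous coordinates, i.e. by families [x] that are
  nonzero on each block; a subset is the predicate satisfied by all the
  homogeneous coordinate vectors of its points. *)

Section Zariski.
Variables (F : fieldType) (V K : finType) (b : V -> K).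
Implicit Types (x : {ffun V -> F}) (p : {mpoly F[#|V|]}).
Implicit Types (X Y Z W : {ffun V -> F} -> Prop).

Definition hpoint x : Prop := forall k, exists2 v, b v = k & x v != 0.

Definition hpeval p x : F := p.@[fun i => x (enum_val i)].

Definition multihomog p : Prop :=
  exists e : K -> nat, forall m, m \in msupp p ->
    forall k, (\sum_(v | b v == k) m (enum_rank v))%N = e k.

Definition zclosed Z : Prop :=
  exists2 S : {mpoly F[#|V|]} -> Prop,
    (forall p, S p -> multihomog p) &
    (forall x, Z x <-> hpoint x /\ (forall p, S p -> hpeval p x = 0)).

Definition zirreducible Y : Prop :=
  (exists x, Y x) /\
  (forall Z W, zclosed Z -> zclosed W -> (forall x, Y x -> Z x \/ W x) ->
     (forall x, Y x -> Z x) \/ (forall x, Y x -> W x)).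

Definition subvariety Y : Prop := zclosed Y /\ zirreducible Y.

(* Krull dimension at least [k] *)
Definition zdim_ge (k : nat) Y : Prop :=
  exists Z : nat -> {ffun V -> F} -> Prop,
    [/\ forall i, (i <= k)%N -> subvariety (Z i),
        forall i, (i < k)%N ->
          (forall x, Z i x -> Z i.+1 x) /\ (exists2 x, Z i.+1 x & ~ Z i x)
      & forall x, Z k x -> Y x].

(* [P] holds for a general point of [X]: it holds on a dense Zariski-open
   subset of [X].  (When [X] is empty this is vacuously true.) *)
Definition for_general X (P : {ffun V -> F} -> Prop) : Prop :=
  exists Z, [/\ zclosed Z,
    forall W, zclosed W -> (forall x, X x -> ~ Z x -> W x) ->
      (forall x, X x -> W x)
    & forall x, X x -> ~ Z x -> P x].

End Zariski.

(** * Projective space with coordinates indexed by [I] *)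

Section ProjectiveSpace.
Variables (F : fieldType) (I : finType).
Implicit Types (w h : {ffun I -> F}).

Definition ppoint w : Prop := hpoint (fun _ : I => tt) w.

Definition proj_eq (w w' : {ffun I -> F}) : Prop :=
  exists2 c : F, c != 0 & forall i, w i = c * w' i.

(* A (projective) linear subspace is given by its cone in [F^I].  The vector
   [h] of homogeneous coordinates on the dual space defines the hyperplane
   \sum_i h_i X_i = 0. *)
Definition hyperplane_contains h (U : {vspace {ffun I -> F^o}}) : Prop :=
  forall u : {ffun I -> F^o}, u \in U -> \sum_i h i * u i = 0.

(* [phi] is a (polynomial) map from F^n to an affine chart of P(F^I), written
   in homogeneous coordinates: the coordinate defining the chart is the
   constant 1.  The cone over the projective closure of the affine subspace
   phi(0) + <partial derivatives of phi at 0 of orders 1, ..., s> is then the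
   linear span of all partial derivatives of orders 0, ..., s. *)
Definition osculating n (s : nat) (phi : I -> {mpoly F[n]}) :
    {vspace {ffun I -> F^o}} :=
  span [seq ([ffun i => (mderivm a (phi i)).@[fun=> 0]] : {ffun I -> F^o})
     | a : 'X_{1..n < s.+1}].

End ProjectiveSpace.

(** * Segre-Veronese varieties

  There are r.+1 factors P^(n_0), ..., P^(n_r), embedded by O(d_0, ..., d_r). *)

Section SegreVeronese.
Variables (F : fieldType) (r : nat) (n d : 'I_r.+1 -> nat).

Definition svvar := {i : 'I_r.+1 & 'I_(n i).+1}.
Definition svx (i : 'I_r.+1) (l : 'I_(n i).+1) : svvar :=
  Tagged (fun i => 'I_(n i).+1) l.

(* Homogeneous coordinates on P^N: exponents of the monomials of multidegree
   [d], which form a basis of the complete linear system. *)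
Definition svmon :=
  {e : {ffun svvar -> 'I_(\sum_i d i).+1} |
    [forall i, (\sum_(l < (n i).+1) e (svx l))%N == d i]}.

Definition svmap (x : {ffun svvar -> F}) : {ffun svmon -> F} :=
  [ffun e : svmon => \prod_v x v ^+ val e v].

Definition SV (w : {ffun svmon -> F}) : Prop :=
  exists2 x : {ffun svvar -> F},
    hpoint (fun v : svvar => tag v) x & proj_eq w (svmap x).

(* Affine coordinates on the product of the charts x_(i, j_i) != 0: there is
   one for each (i, l) with l != j_i, where l = lift (j i) l'. *)
Definition svaff := {i : 'I_r.+1 & 'I_(n i)}.

(* For [x] normalised by [x (svx (j i)) = 1], with remaining coordinates a:
   the homogeneous coordinate v of the point with affine coordinates a + t,
   as a polynomial in the indeterminates t. *)
Definition svchart (j : forall i, 'I_(n i).+1) (x : {ffun svvar -> F})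
    (v : svvar) : {mpoly F[#|{: svaff}|]} :=
  if unlift (j (tag v)) (tagged v) is Some l
  then (x v)%:MP + 'X_(enum_rank (Tagged (fun i => 'I_(n i)) l : svaff))
  else 1.

(* [phi] is the local parametrization of the Segre-Veronese variety near [w]
   coming from one of the standard affine charts of the product. *)
Definition sv_local_param (w : {ffun svmon -> F})
    (phi : svmon -> {mpoly F[#|{: svaff}|]}) : Prop :=
  exists (j : forall i, 'I_(n i).+1) (x : {ffun svvar -> F}),
    [/\ forall i, x (svx (j i)) = 1,
        proj_eq w (svmap x)
      & forall e : svmon, phi e = \prod_v svchart j x v ^+ val e v].

Definition sv_osculating (s : nat) (w : {ffun svmon -> F})
    (T : {vspace {ffun svmon -> F^o}}) : Prop :=
  exists2 phi, sv_local_param w phi & T = osculating s phi.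

Definition sv_tangent (h w : {ffun svmon -> F}) : Prop :=
  exists2 T, sv_osculating 1 w T & hyperplane_contains h T.

End SegreVeronese.

(* Sanity checks: at every point of the variety there is a local
   parametrization; it is centred at that point, takes values in the variety
   and is an immersion at the origin. *)

Section LocalParam.
Variables (F : fieldType) (r : nat) (n d : 'I_r.+1 -> nat).

Lemma svchartE (j : forall i, 'I_(n i).+1) (x : {ffun svvar n -> F}) i l :
  svchart j x (svx (lift (j i) l)) =
    (x (svx (lift (j i) l)))%:MP
    + 'X_(enum_rank (Tagged (fun i => 'I_(n i)) l : svaff n)).
Proof. by rewrite /svchart /= liftK. Qed.

Lemma svchart1 (j : forall i, 'I_(n i).+1) (x : {ffun svvar n -> F}) i :
  svchart j x (svx (j i)) = 1.
Proof. by rewrite /svchart /= unlift_none. Qed.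

Lemma svvarP (j : forall i, 'I_(n i).+1) (v : svvar n) :
  (exists i, v = svx (j i)) \/ (exists i l, v = svx (lift (j i) l)).
Proof.
case: v => i l; case: (unliftP (j i) l) => [l' ->|->]; last by left; exists i.
by right; exists i, l'.
Qed.

Lemma svmap_scale (c : 'I_r.+1 -> F) (x y : {ffun svvar n -> F}) :
  (forall v, x v = c (tag v) * y v) ->
  forall e : svmon n d, svmap d x e = (\prod_i c i ^+ d i) * svmap d y e.
Proof.
move=> xy e; rewrite !ffunE.
rewrite (eq_bigr (fun v => c (tag v) ^+ val e v * y v ^+ val e v)); last first.
  by move=> v _; rewrite xy exprMn.
rewrite big_split /=; congr (_ * _).
rewrite (partition_big (fun v : svvar n => tag v) xpredT) //=.
apply: eq_bigr => i _.
rewrite (eq_bigr (fun v => c i ^+ val e v)); last by move=> v /eqP ->.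
rewrite -expr_sum; congr (_ ^+ _).
have /forallP/(_ i)/eqP <- := valP e.
rewrite (reindex_onto (fun l => svx l : svvar n)
           (fun v : svvar n => if tag v =P i is ReflectT E
                      then eq_rect _ (fun i => 'I_(n i).+1) (tagged v) _ E
                      else ord0)) /=; last first.
  case=> k l /= /eqP ki; case: eqP => // E.
  by move: E; case: _ /.
apply: eq_bigl => l; rewrite eqxx /=.
case: eqP => // E; by rewrite (eq_axiomK E) /= eqxx.
Qed.

Lemma sv_local_param_exists (w : {ffun svmon n d -> F}) :
  SV w -> exists phi, sv_local_param w phi.
Proof.
case=> x xP [c c0 wE].
have jP i : exists l : 'I_(n i).+1, x (svx l) != 0.
  by have [[k l] /= <- xv] := xP i; exists l.
pose j i := xchoose (jP i).
have jN i : x (svx (j i)) != 0 := xchooseP (jP i).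
pose y : {ffun svvar n -> F} := [ffun v => x v / x (svx (j (tag v)))].
exists (fun e : svmon n d => \prod_v svchart j y v ^+ val e v); exists j, y; split=> //.
  by move=> i; rewrite ffunE /= divff.
have xy v : x v = x (svx (j (tag v))) * y v.
  by rewrite ffunE mulrCA divff ?mulr1.
exists (c * \prod_i x (svx (j i)) ^+ d i).
  by rewrite mulf_neq0 // prodf_seq_neq0; apply/allP => i _; rewrite expf_neq0.
by move=> e; rewrite wE (svmap_scale (c := fun i => x (svx (j i))) xy) mulrA.
Qed.

Lemma sv_local_param_at0 (w : {ffun svmon n d -> F}) phi :
  sv_local_param w phi -> proj_eq w [ffun e => (phi e).@[fun=> 0]].
Proof.
case=> j [x [x1 [c c0 wE] phiE]]; exists c => // e.
rewrite wE !ffunE phiE rmorph_prod; congr (_ * _); apply: eq_bigr => v _.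
rewrite rmorphXn /=; congr (_ ^+ _).
have [[i ->]|[i [l ->]]] := svvarP j v.
  by rewrite svchart1 meval1 x1.
by rewrite svchartE mevalD mevalC mevalXU addr0.
Qed.

Lemma sv_local_param_SV (w : {ffun svmon n d -> F}) phi t :
  sv_local_param w phi -> SV [ffun e => (phi e).@[t]].
Proof.
case=> j [x [x1 _ phiE]]; exists [ffun v => (svchart j x v).@[t]].
  by move=> i; exists (svx (j i)); rewrite // ffunE svchart1 meval1 oner_neq0.
exists 1; rewrite ?oner_neq0 // => e; rewrite mul1r !ffunE phiE rmorph_prod.
by apply: eq_bigr => v _; rewrite rmorphXn ffunE.
Qed.

Lemma sv_local_param_immersion (w : {ffun svmon n d -> F}) phi
    (c : 'I_#|{: svaff n}| -> F) :
  (forall i, (0 < d i)%N) ->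
  sv_local_param w phi ->
  (forall e, \sum_a c a * (mderiv a (phi e)).@[fun=> 0] = 0) ->
  forall a, c a = 0.
Proof.
move=> d_gt0 [j [x [_ _ phiE]]] cP a.
case E: (enum_val a) => [i l].
have {E} -> : a = enum_rank (Tagged (fun i => 'I_(n i)) l : svaff n).
  by rewrite -[LHS]enum_valK E.
set v0 : svvar n := svx (lift (j i) l).
pose isj (v : svvar n) := unlift (j (tag v)) (tagged v) == None.
have jj k : isj (svx (j k)) by rewrite /isj /= unlift_none.
have jl k m : isj (svx (lift (j k) m)) = false by rewrite /isj /= liftK.
pose f (v : svvar n) : nat :=
  if v == v0 then 1%N
  else if isj v then (d (tag v) - (tag v == i))%N else 0%N.
have fj k : f (svx (j k)) = (d k - (k == i))%N.
  by rewrite /f jj; case: eqP => // /(congr1 isj); rewrite jj jl.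
have fl k m : f (svx (lift (j k) m)) = (svx (lift (j k) m) == v0)%N.
  by rewrite /f jl; case: eqP.
have fS k : (\sum_(m < (n k).+1) f (svx m) = d k)%N.
  rewrite (bigD1_ord (j k)) //= fj (eq_bigr _ (fun m _ => fl k m)).
  suff -> : (\sum_(m < n k) (svx (lift (j k) m) == v0) = (k == i))%N.
    by rewrite subnK //; case: eqP.
  case: (k =P i) => [->|ki]; last first.
    by rewrite big1 // => m _; apply/eqP; rewrite eqb0; apply/eqP => -[].
  rewrite (bigD1 l) //= eqxx big1 // => m /negbTE ml.
  by rewrite /v0 /svx eq_Tagged /= (inj_eq lift_inj) ml.
have fle v : (f v < (\sum_i d i).+1)%N.
  case: v => k m; rewrite ltnS (bigD1 k) //= -fS (bigD1 m) //=.
  by rewrite -addnA leq_addr.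
pose g : {ffun svvar n -> 'I_(\sum_i d i).+1} := [ffun v => Ordinal (fle v)].
have gP : [forall k, (\sum_(m < (n k).+1) g (svx m))%N == d k].
  apply/forallP => k; rewrite -[X in _ == X]fS; apply/eqP.
  by apply: eq_bigr => m _; rewrite ffunE.
pose e : svmon n d := exist _ g gP.
have eE v : val e v = f v :> nat by rewrite /= ffunE.
have f0 : f v0 = 1%N by rewrite /f eqxx.
have := cP e; have -> : phi e = svchart j x v0.
  rewrite phiE (bigD1 v0) // eE f0 expr1 big1 => [|v]; first exact: mulr1.
  have [[k ->]|[k [m ->]]] := svvarP j v; first by rewrite svchart1 expr1n.
  by move=> vN; rewrite eE fl (negbTE vN) expr0.
rewrite svchartE; set b := enum_rank _.
rewrite (bigD1 b) //= big1 ?addr0 => [|b' b'b].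
  rewrite mderivD mderivC add0r mderivX mnm1E eqxx scale1r.
  by rewrite -{1}[U_(b)%MM]add0m addmK mpolyX0 meval1 mulr1.
rewrite mderivD mderivC add0r mderivX mnm1E eq_sym (negbTE b'b) scale0r.
by rewrite meval0 mulr0.
Qed.

End LocalParam.

(* Main.v *)
(* In the coordinates of a frame adapted to the general points p_0, ..., p_(n_1)
   (their factors are the first basis vectors of each P^(n_i)), the hyperplanes
   containing T are the linear systems spanned by a set M of monomials: those of
   order at least min d at every p_k.  Pure powers of coordinates show that the
   base locus of M is {p_0, ..., p_(n_1)}, unless there is one factor, and then M
   is empty.  By Bertini a general member is smooth off the base locus, so its
   contact locus with the variety is finite.

   Bertini's theorem is proved by counting.  At a point with support S, the
   coefficients c_e = h_e x^e of a singular form satisfy sum c_e = 0 and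
   sum c_e e = 0, linear conditions that do not depend on x; conversely h is
   recovered from c and from the monomials x^(-e), e in M with support in S.
   The dimensions add up to one less than the number of monomials, so comparing
   numbers of monomials of bounded degree gives a nonzero polynomial vanishing on
   all singular forms. *)

Require Import Defs.
From HB Require Import structures.
From mathcomp Require Import all_boot all_order all_algebra.
From mathcomp Require Import mpoly.
From mathcomp Require Import complex reals.
From mathcomp Require Import boolp.
From mathcomp Require Import ring.

Set Implicit Arguments.
Unset Strict Implicit.
Unset Printing Implicit Defensive.

Import Order.TTheory GRing.Theory Num.Theory.
Local Open Scope ring_scope.

(** * Polynomial functions of one variable and their order of vanishing at 0 *)

Section PolynomialFunctions.
Variable F : numFieldType.
Implicit Types (f g : F -> F) (t : F) (s : nat).

(** Containing an osculating space and being tangent are both read as one condition: the form of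
    [h], restricted to every line x + t z in the homogeneous coordinates of the product, is
    divisible by a power of t. This condition names no chart and is compatible with linear changes
    of coordinates in each factor, which makes the passage to an adapted frame possible. Such a
    frame exists as soon as, in each factor, the first n_1 + 1 coordinates of the points form an
    invertible matrix; there is room for it because n_1 is the least n_i. Both occurrences of the
    word general ask for a dense open set. Each is the complement of the zeros of one polynomial,
    and density is checked on polynomial curves, where a product vanishes only if a factor does. So
    Bertini's theorem is needed as a nonzero homogeneous polynomial, which linear algebra on
    monomials provides. Points are sorted by support so that the coordinates inverted in the count
    are nonzero; the supports are finitely many and their polynomials are multiplied. *)

Lemma poly_horner0 (p : {poly F}) : (forall t, p.[t] = 0) -> p = 0.
Proof.
move=> p0; apply/eqP/negPn/negP => pN0.
pose rs := [seq i%:R : F | i <- iota 0 (size p)].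
suff: (size rs < size p)%N by rewrite size_map size_iota ltnn.
apply: max_poly_roots => //; first by apply/allP => x _; apply/rootP.
rewrite map_inj_uniq ?iota_uniq // => i j /eqP.
by rewrite eqr_nat => /eqP.
Qed.

Definition polyfun f := exists p : {poly F}, forall t, f t = p.[t].

(** Order of vanishing at least [s] at 0, stated for functions so that a form restricted to a line
    needs no explicit polynomial. *)
Definition flat s f := exists2 g, polyfun g & forall t, f t = t ^+ s * g t.

Lemma polyfun_ext f g : f =1 g -> polyfun f -> polyfun g.
Proof. by move=> fg [p fp]; exists p => t; rewrite -fg. Qed.

Lemma polyfunC c : polyfun (fun=> c).
Proof. by exists c%:P => t; rewrite hornerC. Qed.

Lemma polyfun_id : polyfun id.
Proof. by exists 'X => t; rewrite hornerX. Qed.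

Lemma polyfunD f g : polyfun f -> polyfun g -> polyfun (fun t => f t + g t).
Proof. by move=> [p fp] [q gq]; exists (p + q) => t; rewrite hornerD fp gq. Qed.

Lemma polyfunM f g : polyfun f -> polyfun g -> polyfun (fun t => f t * g t).
Proof. by move=> [p fp] [q gq]; exists (p * q) => t; rewrite hornerM fp gq. Qed.

Lemma polyfunX f k : polyfun f -> polyfun (fun t => f t ^+ k).
Proof. by move=> [p fp]; exists (p ^+ k) => t; rewrite horner_exp fp. Qed.

Lemma polyfun_sum (J : Type) (r : seq J) (P : pred J) (f : J -> F -> F) :
  (forall j, polyfun (f j)) -> polyfun (fun t => \sum_(j <- r | P j) f j t).
Proof.
move=> pf; elim: r => [|j r IHr].
  by apply: polyfun_ext (polyfunC 0) => t; rewrite big_nil.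
case Pj: (P j).
  by apply: polyfun_ext (polyfunD (pf j) IHr) => t; rewrite big_cons Pj.
by apply: polyfun_ext IHr => t; rewrite big_cons Pj.
Qed.

Lemma polyfun_prod (J : Type) (r : seq J) (P : pred J) (f : J -> F -> F) :
  (forall j, polyfun (f j)) -> polyfun (fun t => \prod_(j <- r | P j) f j t).
Proof.
move=> pf; elim: r => [|j r IHr].
  by apply: polyfun_ext (polyfunC 1) => t; rewrite big_nil.
case Pj: (P j).
  by apply: polyfun_ext (polyfunM (pf j) IHr) => t; rewrite big_cons Pj.
by apply: polyfun_ext IHr => t; rewrite big_cons Pj.
Qed.

Lemma polyfun_meval m (p : {mpoly F[m]}) (x : 'I_m -> F -> F) :
  (forall i, polyfun (x i)) -> polyfun (fun t => p.@[fun i => x i t]).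
Proof.
move=> px.
have: polyfun (fun t => \sum_(a <- msupp p) p@_a * \prod_i x i t ^+ a i).
  apply: polyfun_sum => a; apply: polyfunM; first exact: polyfunC.
  by apply: polyfun_prod => i; apply: polyfunX.
by apply: polyfun_ext => t; rewrite mevalE.
Qed.

Lemma polyfun_mul0 f g : polyfun f -> polyfun g -> (forall t, f t * g t = 0) ->
  (forall t, f t = 0) \/ (forall t, g t = 0).
Proof.
move=> [p fp] [q gq] fg0; have /eqP : p * q = 0.
  by apply: poly_horner0 => t; rewrite hornerM -fp -gq.
by rewrite mulf_eq0 => /orP[]/eqP E; [left|right] => t;
   rewrite ?fp ?gq E horner0.
Qed.

Lemma polyfun_coef0 (J : finType) (a : J -> F) (e : J -> nat) :
  (forall t, \sum_j a j * t ^+ e j = 0) ->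
  forall k, \sum_(j | e j == k) a j = 0.
Proof.
move=> a0 k; have: \sum_j a j *: 'X^(e j) = 0 :> {poly F}.
  apply: poly_horner0 => t; rewrite -[RHS](a0 t) horner_sum.
  by apply: eq_bigr => j _; rewrite hornerZ hornerXn.
move=> /(congr1 (fun p : {poly F} => p`_k)); rewrite coef0 coef_sum => E.
rewrite -[RHS]E big_mkcond; apply: eq_bigr => j _; rewrite coefZ coefXn eq_sym.
by case: eqP; rewrite (mulr1, mulr0).
Qed.

Lemma flat_ext s f g : f =1 g -> flat s f -> flat s g.
Proof. by move=> fg [h ph fh]; exists h => // t; rewrite -fg. Qed.

Lemma flat_polyfun s f : flat s f -> polyfun f.
Proof.
move=> [g pg fg]; apply: polyfun_ext (polyfunM (polyfunX s polyfun_id) pg) => t.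
by rewrite fg.
Qed.

Lemma flat_id : flat 1 id.
Proof. by exists (fun=> 1); [apply: polyfunC|move=> t; rewrite expr1 mulr1]. Qed.

Lemma polyfun_flat0 f : polyfun f -> flat 0 f.
Proof. by move=> pf; exists f => // t; rewrite mul1r. Qed.

Lemma flatW s s' f : (s' <= s)%N -> flat s f -> flat s' f.
Proof.
move=> /subnKC <- [g pg fg]; exists (fun t => t ^+ (s - s') * g t).
  by apply: polyfunM pg; apply/polyfunX/polyfun_id.
by move=> t; rewrite fg exprD mulrA.
Qed.

Lemma flatM s s' f g : flat s f -> flat s' g ->
  flat (s + s') (fun t => f t * g t).
Proof.
move=> [f' pf fE] [g' pg gE]; exists (fun t => f' t * g' t).
  exact: polyfunM.
by move=> t; rewrite fE gE exprD mulrACA.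
Qed.

Lemma flatMl s f g : polyfun f -> flat s g -> flat s (fun t => f t * g t).
Proof. by move=> /polyfun_flat0 f0 /(flatM f0). Qed.

Lemma flatX s k f : flat s f -> flat (s * k) (fun t => f t ^+ k).
Proof.
move=> [g pg fg]; exists (fun t => g t ^+ k); first exact: polyfunX.
by move=> t; rewrite fg exprMn exprM.
Qed.

Lemma flatD s f g : flat s f -> flat s g -> flat s (fun t => f t + g t).
Proof.
move=> [f' pf fE] [g' pg gE]; exists (fun t => f' t + g' t).
  exact: polyfunD.
by move=> t; rewrite fE gE mulrDr.
Qed.

Lemma flat0 s : flat s (fun=> 0).
Proof. by exists (fun=> 0) => [|t]; [apply: polyfunC|rewrite mulr0]. Qed.

Lemma flat_sum s (J : Type) (r : seq J) (P : pred J) (f : J -> F -> F) :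
  (forall j, P j -> flat s (f j)) -> flat s (fun t => \sum_(j <- r | P j) f j t).
Proof.
move=> pf; elim: r => [|j r IHr].
  by apply: flat_ext (flat0 s) => t; rewrite big_nil.
case Pj: (P j).
  by apply: flat_ext (flatD (pf j Pj) IHr) => t; rewrite big_cons Pj.
by apply: flat_ext IHr => t; rewrite big_cons Pj.
Qed.

Lemma flat_prod (J : Type) (r : seq J) (s : J -> nat) (f : J -> F -> F) :
  (forall j, flat (s j) (f j)) ->
  flat (\sum_(j <- r) s j) (fun t => \prod_(j <- r) f j t).
Proof.
move=> pf; elim: r => [|j r IHr].
  rewrite big_nil; apply: polyfun_flat0.
  by apply: polyfun_ext (polyfunC 1) => t; rewrite big_nil.
by rewrite big_cons; apply: flat_ext (flatM (pf j) IHr) => t; rewrite big_cons.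
Qed.

(** A polynomial nonzero at 0 is coprime to the powers of ['X], so it can be cancelled. *)
Lemma flat_unit s f g : polyfun f -> f 0 != 0 -> polyfun g ->
  flat s (fun t => f t * g t) -> flat s g.
Proof.
move=> [p fp] f0 [q gq] [h [u hu] fgh].
have pqE : p * q = 'X^s * u.
  apply/eqP; rewrite -subr_eq0; apply/eqP/poly_horner0 => t.
  by rewrite hornerD hornerN !hornerM hornerXn -fp -gq -hu fgh subrr.
have : 'X^s %| q.
  rewrite -(@Gauss_dvdpr _ _ p); first by rewrite pqE dvdp_mulr.
  apply: coprimep_expl; rewrite coprimep_sym -['X]subr0 -polyC0 coprimep_XsubC.
  by rewrite rootE -fp.
move=> /dvdpP [v qE]; rewrite {}qE in gq; exists (fun t => v.[t]); first by exists v.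
by move=> t; rewrite gq hornerM hornerXn mulrC.
Qed.

Lemma flat_coef0 s (J : finType) (a : J -> F) (e : J -> nat) :
  flat s (fun t => \sum_j a j * t ^+ e j) ->
  forall k, (k < s)%N -> \sum_(j | e j == k) a j = 0.
Proof.
move=> [h [u hu] fh] k ks; have: \sum_j a j *: 'X^(e j) = 'X^s * u.
  apply/eqP; rewrite -subr_eq0; apply/eqP/poly_horner0 => t.
  rewrite hornerD hornerN hornerM hornerXn -hu -fh horner_sum; apply/eqP.
  rewrite subr_eq0; apply/eqP.
  by apply: eq_bigr => j _; rewrite hornerZ hornerXn.
move=> /(congr1 (fun p : {poly F} => p`_k)).
rewrite coef_sum coefXnM ks => E.
rewrite -[RHS]E big_mkcond; apply: eq_bigr => j _; rewrite coefZ coefXn eq_sym.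
by case: eqP; rewrite (mulr1, mulr0).
Qed.

(** The truncated geometric series of [- (t * c)]. With [s.+1] terms its value at 0 is 1 even for
    [s = 0]. *)
Lemma flat_inverse s c : exists2 v, polyfun v &
  v 0 = 1 /\ flat s (fun t => v t * (1 + t * c) - 1).
Proof.
exists (fun t => \sum_(i < s.+1) (- (t * c)) ^+ i); last split.
- apply: polyfun_sum => i; apply: polyfunX.
  have := polyfunM polyfun_id (polyfunC (- c)).
  by apply: polyfun_ext => t; rewrite mulrN.
- by rewrite big_ord_recl mul0r oppr0 expr0 big1 ?addr0 // => i _; rewrite expr0n.
exists (fun t => - (t * (- c) ^+ s.+1)).
  have := polyfunM polyfun_id (polyfunC (- (- c) ^+ s.+1)).
  by apply: polyfun_ext => t; rewrite mulrN.
move=> t; have := subrX1 (- (t * c)) s.+1; set S := \sum_(i < _) _.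
move=> E; have -> : 1 + t * c = - (- (t * c) - 1) by rewrite opprD !opprK addrC.
rewrite mulrN mulrC -E opprB addrAC subrr add0r -mulrN exprMn.
by rewrite mulrN mulrA -exprSr.
Qed.

End PolynomialFunctions.

(** * Polynomials that vanish everywhere and independence of monomials *)

Lemma eq_expansion (B n : nat) (a b : nat -> nat) :
  (forall i, (i < n)%N -> (a i < B)%N) -> (forall i, (i < n)%N -> (b i < B)%N) ->
  (\sum_(i < n) a i * B ^ i = \sum_(i < n) b i * B ^ i)%N ->
  forall i, (i < n)%N -> a i = b i.
Proof.
elim: n a b => // n IHn a b aB bB.
have step (c : nat -> nat) : (\sum_(i < n.+1) c i * B ^ i =
    (\sum_(i < n) c i.+1 * B ^ i) * B + c 0)%N.
  rewrite big_ord_recl expn0 muln1 addnC big_distrl; congr (_ + _)%N.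
  by apply: eq_bigr => i _; rewrite /= /bump /= add1n expnSr mulnA.
rewrite !step => E.
have a0 : a 0%N = b 0%N.
  by have := congr1 (modn^~ B) E; rewrite !modnMDl !modn_small ?aB ?bB.
have B0 : (0 < B)%N by apply: leq_ltn_trans (aB 0%N _).
move: E; rewrite a0 => /addIn/eqP; rewrite eqn_pmul2r // => /eqP E.
case=> // i lei; apply: (IHn (a \o succn) (b \o succn)) => // j ltj; [exact: aB|exact: bB].
Qed.

Section Vanishing.
Variable F : numFieldType.

(* Kronecker's substitution [x_i = t ^ (B ^ i)]. *)
Lemma mpoly_meval0 m (p : {mpoly F[m]}) : (forall x, p.@[x] = 0) -> p = 0.
Proof.
move=> p0; apply/mpolyP => a; rewrite mcoeff0; apply/eqP; apply/negPn/negP => pa.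
(* [B] exceeds every exponent of [p], so [code], which reads an exponent vector as a number in base
   [B], is injective on the support. *)
pose B := (msize p).+1; pose code (b : 'X_{1..m}) := (\sum_(i < m) b i * B ^ i)%N.
have code_inj b c : b \in msupp p -> c \in msupp p -> code b = code c -> b = c.
  move=> bp cp E; apply/mnmP => i.
  pose ext (d : 'X_{1..m}) k := if insub k is Some i then d i else 0%N.
  have extE (d : 'X_{1..m}) (k : 'I_m) : ext d k = d k by rewrite /ext valK.
  rewrite -!extE; have extB d k : d \in msupp p -> (ext d k < B)%N.
    move=> dp; rewrite /ext; case: insubP => // k' _ _.
    rewrite ltnS (leq_trans _ (ltnW (msize_mdeg_lt dp))) // mdegE.
    by rewrite (bigD1 k') //= leq_addr.
  apply: (@eq_expansion B m) => // [k _|k _|]; [exact: extB|exact: extB|].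
  have codeE d : code d = (\sum_(k < m) ext d k * B ^ k)%N.
    by apply: eq_bigr => k _; rewrite extE.
  by rewrite -!codeE.
have: \sum_(b <- msupp p) p@_b *: 'X^(code b) = 0 :> {poly F}.
  apply: poly_horner0 => t; rewrite -(p0 (fun i => t ^+ (B ^ i))) mevalE horner_sum.
  apply: eq_bigr => b _; rewrite hornerZ hornerXn; congr (_ * _).
  by rewrite expr_sum; apply: eq_bigr => i _; rewrite -exprM mulnC.
move=> /(congr1 (fun q : {poly F} => q`_(code a))); rewrite coef0 coef_sum.
have ap : a \in msupp p by rewrite mcoeff_msupp.
rewrite (bigD1_seq a) ?msupp_uniq //= coefZ coefXn eqxx mulr1 big_seq_cond.
rewrite big1 ?addr0 => [|b /andP[bp ba]]; first exact/eqP.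
rewrite coefZ coefXn; case: eqP => [/code_inj E|]; rewrite ?mulr0 //.
by rewrite E ?eqxx in ba.
Qed.

Lemma monomials_free (J W : finType) (a : J -> F) (e : J -> W -> nat) :
  (forall j j', e j =1 e j' -> j = j') ->
  (forall y : W -> F, \sum_j a j * \prod_w y w ^+ e j w = 0) ->
  forall j, a j = 0.
Proof.
move=> e_inj a0 j.
pose mon j : 'X_{1..#|W|} := [multinom e j (enum_val i) | i < #|W|].
have mon_inj : injective mon.
  move=> i i' /mnmP E; apply: e_inj => w.
  by have := E (enum_rank w); rewrite !mnmE enum_rankK.
have: \sum_j a j *: 'X_[mon j] = 0 :> {mpoly F[#|W|]}.
  apply: mpoly_meval0 => x; rewrite raddf_sum -[RHS](a0 (x \o enum_rank)) /=.
  apply: eq_bigr => i _; rewrite mevalZ mevalX; congr (_ * _).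
  rewrite (reindex (@enum_rank W)) /=; last by apply: onW_bij; apply: enum_rank_bij.
  by apply: eq_bigr => w _; rewrite mnmE enum_rankK.
move=> /(congr1 (fun p : {mpoly F[#|W|]} => p@_(mon j))); rewrite mcoeff0.
rewrite raddf_sum (bigD1 j) //= mcoeffZ mcoeffX eqxx mulr1.
rewrite big1 ?addr0 // => i ij; rewrite mcoeffZ mcoeffX (inj_eq mon_inj).
by rewrite (negbTE ij) mulr0.
Qed.

End Vanishing.

(** * A polynomial vanishing on singular forms, by counting monomials *)

Section Counting.
Variable F : numFieldType.

Lemma left_kernel (I J : finType) (M : I -> J -> F) : (#|J| < #|I|)%N ->
  exists2 a : I -> F, exists i, a i != 0 & forall j, \sum_i a i * M i j = 0.
Proof.
move=> ltJI; pose A := \matrix_(i < #|I|, j < #|J|) M (enum_val i) (enum_val j).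
have : kermx A != 0.
  rewrite -mxrank_eq0 mxrank_ker subn_eq0 -ltnNge.
  exact: leq_ltn_trans (rank_leq_col A) ltJI.
move=> /rowV0Pn[v /sub_kermxP vA0 vN0]; exists (fun i => v 0 (enum_rank i)).
  have /rV0Pn[i vi] := vN0.
  by exists (enum_val i); rewrite enum_valK.
move=> j; have /matrixP/(_ 0 (enum_rank j)) := vA0; rewrite !mxE => E.
rewrite -[RHS]E (reindex (@enum_val I I)) /=; last by apply: onW_bij; apply: enum_val_bij.
by apply: eq_bigr => i _; rewrite mxE enum_valK enum_rankK.
Qed.

Lemma mpoly_indexed (m : nat) (J : finType) (mon : J -> 'X_{1..m})
    (p : {mpoly F[m]}) :
  injective mon -> {in msupp p, forall a, exists j, a = mon j} ->
  p = \sum_j p@_(mon j) *: 'X_[mon j].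
Proof.
move=> mon_inj supp; apply/mpolyP => a; rewrite raddf_sum /=.
have [/supp[j ->]|aN] := boolP (a \in msupp p).
  rewrite (bigD1 j) //= mcoeffZ mcoeffX eqxx mulr1 big1 ?addr0 // => k kj.
  by rewrite mcoeffZ mcoeffX (inj_eq mon_inj) (negbTE kj) mulr0.
rewrite (memN_msupp_eq0 aN) big1 // => j _; rewrite mcoeffZ mcoeffX.
by case: eqP => [E|]; rewrite ?mulr0 // E (memN_msupp_eq0 aN) mul0r.
Qed.

Lemma dhomog_bigprod (m : nat) (J : Type) (r : seq J) (k : J -> nat)
    (p : J -> {mpoly F[m]}) :
  (forall j, p j \is (k j).-homog) ->
  \prod_(j <- r) p j \is (\sum_(j <- r) k j).-homog.
Proof.
move=> hp; elim: r => [|j r IHr]; first by rewrite !big_nil dhomog1.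
by rewrite !big_cons dhomogM.
Qed.

Section Discriminant.
Variables (N : nat) (V : finType) (ex : 'I_N -> V -> nat) (m0 : V -> nat).

(** Eliminating [c0 = - \sum_i c i] turns the linear conditions on a singular form into
    [c *m A = 0]; the rows of [A] are also the exponents of the quotients by the monomial [m0]. *)
Let A := \matrix_(i < N, v < #|V|)
  ((ex i (enum_val v))%:R - (m0 (enum_val v))%:R : F).
Let dm := (\sum_v m0 v + \sum_i \sum_v ex i v)%N.
(** [C] and [D] are chosen for [card_target]: both bases of the target count are at most [C * D.+1],
    and [(C * D.+1) ^ N = D * D.+1 ^ N] falls short of the [D.+1 ^ N.+1] elements of [box]. *)
Let C := (N.+1 * dm.+1)%N.
Let D := (C ^ N)%N.
Let box := {ffun option 'I_N -> 'I_D.+1}.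
Let K := (N * D)%N.
Let wt (b : box) := (\sum_i b (Some i))%N.
(** The exponent of [w v] once denominators are cleared by the [K]-th power of the monomial [m0];
    the subtraction is exact since [wt b <= K]. *)
Let kap (b : box) v := (\sum_i b (Some i) * ex i v + (K - wt b) * m0 v)%N.
Let f := maxrankfun A^T.
Let q := \rank (kermx A).
Let B1 := (N.+1 * D).+1.
Let key (b : box) := [ffun k => inord (kap b (enum_val (f k)))
  : 'I_(K * dm).+1].
(** The coordinate [c i] on the left kernel of [A], in [q] parameters; [Psi b] is the monomial [b]
    in [c0] and the [c i], written in these parameters. *)
Let L i : {mpoly F[q]} := \sum_k row_base (kermx A) k i *: 'X_k.
Let Psi (b : box) := (- \sum_i L i) ^+ b None * \prod_i L i ^+ b (Some i).

Let wt_le b : (wt b <= K)%N.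
Proof.
rewrite /wt /K -[X in (_ <= X * _)%N]card_ord -sum_nat_const leq_sum // => i _.
by rewrite -ltnS.
Qed.

Let kap_le b v : (kap b v <= K * dm)%N.
Proof.
have le_ex i : (ex i v <= dm)%N.
  apply: leq_trans (leq_addl _ _).
  by rewrite (bigD1 i) //= (bigD1 v) //= -addnA leq_addr.
have le_m0 : (m0 v <= dm)%N.
  by rewrite /dm (bigD1 v) //= -!addnA leq_addr.
rewrite -(subnKC (wt_le b)) mulnDl leq_add //.
  by rewrite /wt big_distrl /= leq_sum // => i _; rewrite leq_mul2l le_ex orbT.
by rewrite leq_mul2l le_m0 orbT.
Qed.

Let kapE b v : (kap b v)%:R = (K * m0 v)%:R +
  ((\row_i ((b (Some i))%:R : F)) *m A) 0 (enum_rank v).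
Proof.
rewrite mxE natrD natrM natrB ?wt_le // mulrBl.
have -> : \sum_i (\row_i ((b (Some i))%:R : F)) 0 i * A i (enum_rank v) =
    \sum_i (b (Some i) * ex i v)%:R - \sum_i (b (Some i))%:R * (m0 v)%:R.
  rewrite -sumrB; apply: eq_bigr => i _.
  by rewrite !mxE enum_rankK mulrBr natrM.
by rewrite -mulr_suml -!natr_sum natrM addrCA.
Qed.

(** Up to the constant [K * m0 v], [kap b v] is an entry of the product of the row [b] by [A], hence
    determined by the entries at the columns chosen by [f], a basis of the column space. *)
Let key_inj b b' : key b = key b' -> kap b =1 kap b'.
Proof.
move=> /ffunP eq_key v.
have keyE k : kap b (enum_val (f k)) = kap b' (enum_val (f k)).
  have /(congr1 val) := eq_key k.
  by rewrite /key !ffunE /= !inordK ?ltnS ?kap_le.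
apply/eqP; rewrite -(eqr_nat F) !kapE; apply/eqP; congr (_ + _).
suff -> : \row_i ((b (Some i))%:R : F) *m A = \row_i ((b' (Some i))%:R : F) *m A by [].
have /submxP[X AX] : (A^T <= rowsub f A^T)%MS by rewrite eq_maxrowsub.
apply: trmx_inj; rewrite !trmx_mul AX -!mulmxA; congr (_ *m _).
apply/matrixP => k j; rewrite (ord1 j).
have /eqP := keyE k; rewrite -(eqr_nat F) !kapE !enum_valK => /eqP/addrI.
have tE (u : 'rV[F]_N) : (rowsub f A^T *m u^T) k 0 = (u *m A) 0 (f k).
  by rewrite !mxE; apply: eq_bigr => i _; rewrite !mxE mulrC.
by rewrite !tE.
Qed.

Let L_homog i : L i \is 1.-homog.
Proof. by apply: rpred_sum => k _; apply: rpredZ; rewrite dhomogX /= mdeg1. Qed.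

Let Psi_homog b : Psi b \is (b None + wt b).-homog.
Proof.
rewrite /wt; apply: dhomogM.
  rewrite -[X in X.-homog]mul1n; apply: dhomogMn.
  by rewrite rpredN; apply: rpred_sum => i _; apply: L_homog.
by apply: dhomog_bigprod => i; rewrite -[X in X.-homog]mul1n; apply: dhomogMn; apply: L_homog.
Qed.

Let mon (al : {ffun 'I_q -> 'I_B1}) : 'X_{1..q} := [multinom (al i : nat) | i < q].

Let PsiE b : Psi b = \sum_al (Psi b)@_(mon al) *: 'X_[mon al].
Proof.
apply: mpoly_indexed => [al al' /mnmP E|a a_supp].
  by apply/ffunP => i; apply/val_inj; have := E i; rewrite !mnmE.
have a_lt i : (a i < B1)%N.
  have := dhomog_mf (Psi_homog b) a_supp; rewrite /= mdegE => aE.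
  rewrite ltnS (@leq_trans (\sum_i a i)%N) //; first by rewrite (bigD1 i) //= leq_addr.
  by rewrite aE mulSn leq_add ?wt_le // -ltnS.
by exists [ffun i => Ordinal (a_lt i)]; apply/mnmP => i; rewrite mnmE ffunE.
Qed.

Let card_target :
  (#|{: {ffun 'I_q -> 'I_B1} * {ffun 'I_(\rank A^T) -> 'I_(K * dm).+1}}|
    < #|{: box}|)%N.
Proof.
rewrite card_prod !card_ffun !card_ord card_option card_ord.
have C_gt0 : (0 < C)%N by rewrite muln_gt0.
have leC x : (x <= C -> (x * D).+1 <= C * D.+1)%N.
  by move=> xC; rewrite mulnS -add1n leq_add // leq_mul2r xC orbT.
have B1_le : (B1 <= C * D.+1)%N by rewrite leC // leq_pmulr.
have B2_le : ((K * dm).+1 <= C * D.+1)%N.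
  by rewrite /K mulnAC leC // leq_mul.
apply: (@leq_ltn_trans ((C * D.+1) ^ q * (C * D.+1) ^ \rank A^T)).
  have leX x y e : (x <= y -> x ^ e <= y ^ e)%N.
    by case: e => // e; rewrite leq_exp2r.
  by rewrite leq_mul // leX.
rewrite -expnD mxrank_tr /q mxrank_ker subnK ?rank_leq_row // expnMn expnS.
by rewrite ltn_pmul2r ?expn_gt0 // ltnS leqnn.
Qed.

(* The monomials in [c0], [c] and [w] depend on [N] parameters only: a linear
   coordinate system on the kernel of [A] together with a column basis for the
   exponents [ex i - m0].  There are more monomials of bounded degree in [N.+1]
   variables than in [N]. *)
Lemma discriminant_affine : exists D0,
  exists2 a : {ffun option 'I_N -> 'I_D0.+1} -> F, exists b, a b != 0 &
  forall (c0 : F) (c : 'I_N -> F) (w : V -> F), (forall v, w v != 0) ->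
    c0 + \sum_i c i = 0 ->
    (forall v, c0 * (m0 v)%:R + \sum_i c i * (ex i v)%:R = 0) ->
    \sum_b a b * (c0 ^+ b None * \prod_i
      (c i * (\prod_v w v ^+ ex i v / \prod_v w v ^+ m0 v)) ^+ b (Some i)) = 0.
Proof.
(* The monomial [b] is a combination, with coefficients [M b], of products of a monomial in the
   kernel parameters and a function of the key; a left null vector of [M] kills all of them at
   once. *)
pose M (b : box) (j : {ffun 'I_q -> 'I_B1} * {ffun 'I_(\rank A^T) -> 'I_(K * dm).+1}) :=
  (Psi b)@_(mon j.1) * (key b == j.2)%:R.
have [a aN0 aM] := left_kernel M card_target; exists D, a => // c0 c w wN0 c0E cE.
have sumc : \sum_i c i = - c0 by apply/eqP; rewrite -addr_eq0 addrC c0E.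
have /submxP[s sE] : (\row_i c i <= row_base (kermx A))%MS.
  rewrite eq_row_base; apply/sub_kermxP/matrixP => i v; rewrite !mxE.
  under eq_bigr do rewrite !mxE mulrBr.
  by rewrite sumrB -mulr_suml sumc mulNr opprK addrC cE.
have LE i : (L i).@[s 0] = c i.
  have /matrixP/(_ 0 i) := sE; rewrite !mxE => ->; rewrite raddf_sum /=.
  by apply: eq_bigr => k _; rewrite mevalZ mevalXU mulrC.
have PsiE' (b : box) : (Psi b).@[s 0] = c0 ^+ b None * \prod_i c i ^+ b (Some i).
  have sumL : (\sum_i L i).@[s 0] = - c0.
    by rewrite raddf_sum -sumc; apply: eq_bigr => i _; apply: LE.
  rewrite mevalM rmorphXn rmorph_prod /= mevalN sumL opprK; congr (_ * _).
  by apply: eq_bigr => i _; rewrite rmorphXn /= LE.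
pose P0 := \prod_v w v ^+ m0 v.
have P0N0 : P0 != 0 by apply/prodf_neq0 => v _; rewrite expf_neq0.
pose W (b : box) := \prod_v w v ^+ kap b v / P0 ^+ K.
have WE (b : box) : \prod_i (\prod_v w v ^+ ex i v / P0) ^+ b (Some i) = W b.
  rewrite (eq_bigr (fun i => \prod_v w v ^+ (b (Some i) * ex i v) *
    P0^-1 ^+ b (Some i))); last first.
    move=> i _; rewrite exprMn; congr (_ * _); rewrite -prodrXl.
    by apply: eq_bigr => v _; rewrite mulnC exprM.
  rewrite big_split /= exchange_big /= -expr_sum /W.
  rewrite [X in _ = X / _](eq_bigr (fun v => \prod_i w v ^+ (b (Some i) * ex i v)
    * (w v ^+ m0 v) ^+ (K - wt b))); last first.
    by move=> v _; rewrite /kap exprD expr_sum; congr (_ * _); rewrite mulnC exprM.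
  rewrite big_split /= prodrXl -/P0 -mulrA; congr (_ * _).
  have -> : P0 ^+ K = P0 ^+ (K - wt b) * P0 ^+ wt b by rewrite -exprD subnK ?wt_le.
  by rewrite invfM mulrA divff ?expf_neq0 // mul1r exprVn.
(* [W b] depends on [b] only through its key, so it descends to keys. *)
pose g ch := if [pick b : box | key b == ch] is Some b then W b else 0.
have gE (b : box) : g (key b) = W b.
  rewrite /g; case: pickP => [b' /eqP /key_inj kk|/(_ b)]; last by rewrite eqxx.
  by rewrite /W; congr (_ / _); apply: eq_bigr => v _; rewrite kk.
pose mo al := \prod_i s 0 i ^+ mon al i.
have phiE (b : box) : c0 ^+ b None * \prod_i (c i * (\prod_v w v ^+ ex i v / P0)) ^+ b (Some i)
    = \sum_j M b j * (mo j.1 * g j.2).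
  under eq_bigr do rewrite exprMn.
  rewrite big_split /= WE mulrA -PsiE' PsiE raddf_sum /= big_distrl /=.
  rewrite -(pair_bigA _ (fun al ch => M b (al, ch) * (mo al * g ch))) /=.
  apply: eq_bigr => al _; rewrite (bigD1 (key b)) //= big1 ?addr0 => [|ch chN].
    by rewrite /M /= eqxx mulr1 gE mevalZ mevalX [RHS]mulrA.
  by rewrite /M /= eq_sym (negbTE chN) mulr0 mul0r.
rewrite (eq_bigr (fun b => \sum_j a b * (M b j * (mo j.1 * g j.2)))); last first.
  by move=> b _; rewrite -big_distrr -phiE.
rewrite exchange_big big1 //= => j _.
under eq_bigr do rewrite mulrA.
by rewrite -mulr_suml aM mul0r.
Qed.

End Discriminant.

(** One element [m0] of [E] serves as denominator in the affine relation. The conditions on [c] are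
    stable under scaling, so each homogeneous component of the relation vanishes by itself; the
    component containing [b0] is kept because [a b0 != 0]. *)
Lemma discriminant (J V : finType) (E : {set J}) (ex : J -> V -> nat) :
  E != set0 -> exists k, exists P : {mpoly F[#|J|]},
  [/\ P \is k.-homog, P != 0,
      forall h h' : J -> F, {in E, h =1 h'} ->
        P.@[fun i => h (enum_val i)] = P.@[fun i => h' (enum_val i)]
    & forall (c : J -> F) (w : V -> F), (forall v, w v != 0) ->
        \sum_(j in E) c j = 0 ->
        (forall v, \sum_(j in E) c j * (ex j v)%:R = 0) ->
        P.@[fun i => c (enum_val i) * \prod_v w v ^+ ex (enum_val i) v] = 0].
Proof.
move=> /set0Pn[m0 m0E]; pose N := #|E :\ m0|.
pose jj (o : option 'I_N) := if o is Some i then enum_val i else m0.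
have jj_inj : injective jj.
  move=> [i|] [i'|] //= => [/enum_val_inj-> //|E1|E1].
    by have := enum_valP i; rewrite E1 setD11.
  by have := enum_valP i'; rewrite -E1 setD11.
have jjE o : jj o \in E.
  by case: o => [i|] //=; have := enum_valP i; rewrite inE => /andP[].
have sumE (G : J -> F) : \sum_(j in E) G j = G (jj None) + \sum_i G (jj (Some i)).
  rewrite (bigD1 m0) //=; congr (_ + _).
  transitivity (\sum_(j in E :\ m0) G j); last by rewrite big_enum_val.
  by apply: eq_bigl => j; rewrite !inE andbC.
have [D [a [b0 ab0] aP]] := discriminant_affine (fun i => ex (jj (Some i))) (ex m0).
pose deg (b : {ffun option 'I_N -> 'I_D.+1}) := (\sum_(o : option 'I_N) b o)%N.
pose mo (b : {ffun option 'I_N -> 'I_D.+1}) : {mpoly F[#|J|]} := \prod_o 'X_(enum_rank (jj o)) ^+ b o.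
pose P := \sum_(b | deg b == deg b0) a b *: mo b.
have PE h : P.@[h] = \sum_(b | deg b == deg b0)
    a b * \prod_o h (enum_rank (jj o)) ^+ b o.
  rewrite /P raddf_sum /=; apply: eq_bigr => b _; rewrite mevalZ rmorph_prod /=.
  by congr (_ * _); apply: eq_bigr => o _; rewrite rmorphXn /= mevalXU.
exists (deg b0), P; split.
- apply: rpred_sum => b /eqP <-; apply: rpredZ; apply: dhomog_bigprod => o.
  by rewrite -[X in X.-homog]mul1n; apply: dhomogMn; rewrite dhomogX /= mdeg1.
- apply: contraNneq ab0 => P0; apply/eqP.
  pose a' b := if deg b == deg b0 then a b else 0.
  have -> : a b0 = a' b0 by rewrite /a' eqxx.
  apply: (@monomials_free F _ _ a' (fun b o => nat_of_ord (b o))) => [b b' bb|y].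
    by apply/ffunP => o; apply/val_inj; apply: bb.
  pose h i := if [pick o | enum_rank (jj o) == i] is Some o then y o else 0.
  have hE o : h (enum_rank (jj o)) = y o.
    rewrite /h; case: pickP => [o' /eqP/enum_rank_inj/jj_inj-> //|/(_ o)].
    by rewrite eqxx.
  rewrite -[RHS](meval0 h) -P0 PE [RHS]big_mkcond; apply: eq_bigr => b _.
  rewrite /a'; case: ifP => _; rewrite ?mul0r //; congr (_ * _).
  by apply: eq_bigr => o _; rewrite hE.
- move=> h h' hh; rewrite !PE; apply: eq_bigr => b _; congr (_ * _).
  by apply: eq_bigr => o _; rewrite enum_rankK hh.
move=> c w wN0 csum cex; rewrite PE.
pose p0 := \prod_v w v ^+ ex m0 v.
have p0N0 : p0 != 0 by apply/prodf_neq0 => v _; rewrite expf_neq0.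
pose X (b : {ffun option 'I_N -> 'I_D.+1}) := c m0 ^+ b None * \prod_i (c (jj (Some i)) *
  (\prod_v w v ^+ ex (jj (Some i)) v / p0)) ^+ b (Some i).
have degE b : deg b = (b None + \sum_i b (Some i))%N.
  rewrite /deg (bigD1 None) //=; congr (_ + _)%N.
  rewrite (reindex_omap Some id) => [|[]] //.
  by apply: eq_bigl => i; rewrite eqxx.
have /(_ (deg b0)) X0 : forall k, \sum_(b | deg b == k) a b * X b = 0.
  apply: polyfun_coef0 => t.
  rewrite -[RHS](aP (t * c m0) (fun i => t * c (jj (Some i))) w) //.
  - apply: eq_bigr => b _; rewrite -mulrA; congr (_ * _).
    have -> : \prod_i (t * c (jj (Some i)) * (\prod_v w v ^+ ex (jj (Some i)) v
        / \prod_v w v ^+ ex m0 v)) ^+ b (Some i) = t ^+ (\sum_i b (Some i)) *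
        \prod_i (c (jj (Some i)) * (\prod_v w v ^+ ex (jj (Some i)) v / p0))
          ^+ b (Some i).
      rewrite expr_sum -big_split; apply: eq_bigr => i _ /=.
      by rewrite -mulrA exprMn.
    by rewrite degE exprMn exprD [RHS]mulrACA [RHS]mulrC.
  - by rewrite -big_distrr /= -mulrDr -(sumE c) csum mulr0.
  - move=> v; under eq_bigr do rewrite -mulrA.
    by rewrite -mulrA -big_distrr /= -mulrDr -(sumE (fun j => c j * (ex j v)%:R)) cex mulr0.
(* All terms have degree [deg b0], so one power of [p0] clears their denominators. *)
rewrite -[RHS](mulr0 (p0 ^+ deg b0)) -[in RHS]X0 big_distrr /=.
apply: eq_bigr => b /eqP <-; rewrite mulrCA; congr (_ * _).
rewrite (bigD1 None) //= enum_rankK exprMn -/p0 degE exprD /X.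
rewrite [X in _ * _ * X = _](_ : _ = p0 ^+ (\sum_i b (Some i)) *
  \prod_i (c (jj (Some i)) * (\prod_v w v ^+ ex (jj (Some i)) v / p0))
    ^+ b (Some i)).
  by rewrite [X in X * _]mulrC mulrACA.
rewrite expr_sum -big_split /= (reindex_omap Some id) => [|[]] //=.
apply: eq_big => [i|i _]; first by rewrite eqxx.
by rewrite -exprMn enum_rankK mulrCA [p0 * _]mulrC divfK.
Qed.

End Counting.

(** * Multihomogeneous polynomials *)

Section Multihomogeneous.
Variables (F : numFieldType) (V K : finType) (b : V -> K).
Implicit Types (p q : {mpoly F[#|V|]}) (D : K -> nat).

Definition multideg D p : Prop := forall m, m \in msupp p ->
  forall k, (\sum_(v | b v == k) m (enum_rank v))%N = D k.

Lemma multideg_homog D p : multideg D p -> multihomog b p.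
Proof. by move=> pD; exists D. Qed.

Lemma multideg_ext D D' p : D =1 D' -> multideg D p -> multideg D' p.
Proof. by move=> DD pD m mp k; rewrite -DD pD. Qed.

Lemma multidegM D D' p q : multideg D p -> multideg D' q ->
  multideg (fun k => D k + D' k)%N (p * q).
Proof.
move=> pD qD m /msuppM_le/allpairsP[[m1 m2] /= [m1p m2q ->]] k.
by rewrite -(pD _ m1p) -(qD _ m2q) -big_split; apply: eq_bigr => v _; rewrite mnmDE.
Qed.

Lemma multideg1 : multideg (fun=> 0%N) 1.
Proof.
by move=> m; rewrite msupp1 inE => /eqP-> k; rewrite big1 // => v _; rewrite mnm0E.
Qed.

Lemma multidegX D p e : multideg D p -> multideg (fun k => D k * e)%N (p ^+ e).
Proof.
move=> pD; elim: e => [|e IHe].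
  by rewrite expr0; apply: multideg_ext multideg1 => k; rewrite muln0.
by rewrite exprS; apply: multideg_ext (multidegM pD IHe) => k; rewrite mulnS.
Qed.

Lemma multideg_prod (J : Type) (s : seq J) (D : J -> K -> nat)
    (p : J -> {mpoly F[#|V|]}) : (forall j, multideg (D j) (p j)) ->
  multideg (fun k => \sum_(j <- s) D j k)%N (\prod_(j <- s) p j).
Proof.
move=> pD; elim: s => [|j s IHs].
  by rewrite big_nil; apply: multideg_ext multideg1 => k; rewrite big_nil.
rewrite big_cons; apply: multideg_ext (multidegM (pD j) IHs) => k.
by rewrite big_cons.
Qed.

Lemma multidegZ D c p : multideg D p -> multideg D (c *: p).
Proof. by move=> pD m /msuppZ_le/pD. Qed.

Lemma multideg_sum (J : Type) (s : seq J) (P : pred J) D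
    (p : J -> {mpoly F[#|V|]}) : (forall j, P j -> multideg D (p j)) ->
  multideg D (\sum_(j <- s | P j) p j).
Proof.
move=> pD; elim/big_ind: _ => [m|p1 p2 h1 h2 m /msuppD_le|j /pD //].
  by rewrite msupp0.
by rewrite mem_cat => /orP[/h1|/h2].
Qed.

Lemma multideg_var v : multideg (fun k => (b v == k) : nat) 'X_(enum_rank v).
Proof.
move=> m; rewrite msuppX inE => /eqP-> k.
have [bv|bv] := boolP (b v == k).
  rewrite (bigD1 v) //= mnm1E eqxx big1 // => v' /andP[_ v'v].
  by rewrite mnm1E (inj_eq enum_rank_inj) eq_sym (negbTE v'v).
rewrite big1 // => v' bv'; rewrite mnm1E (inj_eq enum_rank_inj).
by suff /negbTE-> : v != v' by []; apply: contraNneq bv => ->.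
Qed.

End Multihomogeneous.

(** * The Segre-Veronese map and linear changes of coordinates in the factors *)

Section SegreVeroneseMap.
Variables (F : numFieldType) (r : nat) (n d : 'I_r.+1 -> nat).
Local Notation V := (svvar n).
Local Notation mon := (svmon n d).
Implicit Types (x y z : {ffun V -> F}) (e : mon) (h : mon -> F).

Definition svexp e (v : V) : nat := val e v.

Lemma svmapE x e : svmap d x e = \prod_v x v ^+ svexp e v.
Proof. by rewrite ffunE. Qed.

Lemma svmonE e i : (\sum_(l < (n i).+1) svexp e (svx l))%N = d i.
Proof. by have /forallP/(_ i)/eqP := valP e. Qed.

Lemma svsum (T : Type) (idx : T) (op : Monoid.com_law idx) (G : V -> T) :
  \big[op/idx]_v G v = \big[op/idx]_i \big[op/idx]_(l < (n i).+1) G (svx l).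
Proof. by rewrite sig_big_dep; apply: eq_bigr => -[]. Qed.

Lemma svsum_block i (G : V -> nat) :
  (\sum_(v | tag v == i) G v = \sum_(l < (n i).+1) G (svx l))%N.
Proof.
rewrite big_mkcond svsum (bigD1 i) //= eqxx [X in (_ + X)%N]big1 ?addn0 // => j /negbTE ji.
by rewrite big1 // => l _; rewrite ji.
Qed.

Lemma svmon_exists (f : V -> nat) :
  (forall i, \sum_(l < (n i).+1) f (svx l) = d i)%N ->
  exists e : mon, svexp e =1 f.
Proof.
move=> fS; have fle v : (f v < (\sum_i d i).+1)%N.
  case: v => k m; rewrite ltnS (bigD1 k) //= -fS (bigD1 m) //=.
  by rewrite -addnA leq_addr.
pose g : {ffun V -> 'I_(\sum_i d i).+1} := [ffun v => Ordinal (fle v)].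
have gP : [forall k, (\sum_(m < (n k).+1) g (svx m))%N == d k].
  apply/forallP => k; rewrite -[X in _ == X]fS; apply/eqP.
  by apply: eq_bigr => m _; rewrite ffunE.
by exists (exist _ g gP) => v; rewrite /svexp /= ffunE.
Qed.

Lemma svmon_inj e e' : svexp e =1 svexp e' -> e = e'.
Proof. by move=> ee; apply/val_inj/ffunP => v; apply/val_inj/ee. Qed.

Lemma svmap_free h : (forall x, \sum_e h e * svmap d x e = 0) -> forall e, h e = 0.
Proof.
move=> h0; apply: (@monomials_free F _ _ h svexp).
  exact: svmon_inj.
move=> y; rewrite -[RHS](h0 (finfun y)); apply: eq_bigr => e _.
by rewrite svmapE; congr (_ * _); apply: eq_bigr => v _; rewrite ffunE.
Qed.

Definition blockact (g : forall i, 'M[F]_((n i).+1)) x : {ffun V -> F} :=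
  [ffun v => \sum_l g (tag v) (tagged v) l * x (svx l)].

(** A linear change in each factor turns a monomial of multidegree [d] into a form of multidegree
    [d], whose coefficients are the entries of [C]. *)
Lemma svmap_blockact g : exists C : mon -> mon -> F, forall x e,
  svmap d (blockact g x) e = \sum_e' C e e' * svmap d x e'.
Proof.
pose p e : {mpoly F[#|{: V}|]} :=
  \prod_v (\sum_l g (tag v) (tagged v) l *: 'X_(enum_rank (svx l))) ^+ svexp e v.
pose mo e : 'X_{1..#|{: V}|} := [multinom svexp e (enum_val i) | i < #|{: V}|].
have mo_inj : injective mo.
  move=> e e' /mnmP E; apply: svmon_inj => v.
  by have := E (enum_rank v); rewrite !mnmE enum_rankK.
have pD e : multideg (fun v : V => tag v) d (p e).
  apply: (@multideg_ext _ _ _ _ (fun k => \sum_v (tag v == k) * svexp e v)%N).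
    move=> k; rewrite -(svmonE e k) -(svsum_block k (svexp e)).
    rewrite [RHS]big_mkcond.
    by apply: eq_bigr => v _; rewrite mulnbl.
  apply: multideg_prod => v; apply: multidegX; apply: multideg_sum => l _.
  by apply: multidegZ; apply: multideg_var.
exists (fun e e' => (p e)@_(mo e')) => x e.
transitivity ((p e).@[fun i => x (enum_val i)]).
  rewrite svmapE rmorph_prod; apply: eq_bigr => v _; rewrite rmorphXn ffunE raddf_sum.
  congr (_ ^+ _); apply: eq_bigr => l _.
  by rewrite /= mevalZ mevalXU enum_rankK.
rewrite {1}[p e](mpoly_indexed mo_inj) => [|a ap].
  rewrite raddf_sum; apply: eq_bigr => e' _; rewrite /= mevalZ mevalX svmapE.
  congr (_ * _); rewrite (reindex (@enum_rank V)) /=; last exact/onW_bij/enum_rank_bij.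
  by apply: eq_bigr => v _; rewrite mnmE enum_rankK.
have [|e' e'E] := @svmon_exists (fun v => a (enum_rank v)).
  by move=> i; rewrite -(svsum_block i (fun v => a (enum_rank v))) (pD e _ ap).
by exists e'; apply/mnmP => i; rewrite mnmE e'E enum_valK.
Qed.

End SegreVeroneseMap.

(** * Order of vanishing at 0 of polynomials in several variables *)

Section FlatPolynomials.
Variable F : numFieldType.

Definition eqflat s (f g : F -> F) : Prop :=
  [/\ polyfun f, polyfun g & flat s (fun t => f t - g t)].

Lemma eqflatM s f f' g g' : eqflat s f f' -> eqflat s g g' ->
  eqflat s (fun t => f t * g t) (fun t => f' t * g' t).
Proof.
move=> [pf pf' ff'] [pg pg' gg']; split; [exact: polyfunM|exact: polyfunM|].
apply: flat_ext (flatD (flatMl pf gg') (flatMl pg' ff')) => t.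
by rewrite mulrBr mulrBr [g' t * _]mulrC [g' t * _]mulrC addrA subrK.
Qed.

Lemma eqflatX s f g k : eqflat s f g ->
  eqflat s (fun t => f t ^+ k) (fun t => g t ^+ k).
Proof.
move=> fg; elim: k => [|k IHk].
  split; [exact: polyfunC|exact: polyfunC|].
  by apply: flat_ext (flat0 F s) => t; rewrite subrr.
have [pf pg H] := eqflatM fg IHk.
split; last by apply: flat_ext H => t; rewrite -!exprS.
  by apply: polyfun_ext pf => t; rewrite -exprS.
by apply: polyfun_ext pg => t; rewrite -exprS.
Qed.

Lemma eqflat_prod s (J : Type) (l : seq J) (f g : J -> F -> F) :
  (forall j, eqflat s (f j) (g j)) ->
  eqflat s (fun t => \prod_(j <- l) f j t) (fun t => \prod_(j <- l) g j t).
Proof.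
move=> fg; elim: l => [|j l IHl].
  split; last by apply: flat_ext (flat0 F s) => t; rewrite !big_nil subrr.
    by apply: polyfun_ext (polyfunC 1) => t; rewrite big_nil.
  by apply: polyfun_ext (polyfunC 1) => t; rewrite big_nil.
have [pf pg H] := eqflatM (fg j) IHl.
split; last by apply: flat_ext H => t; rewrite !big_cons.
  by apply: polyfun_ext pf => t; rewrite big_cons.
by apply: polyfun_ext pg => t; rewrite big_cons.
Qed.

Lemma meval_at0 m (p : {mpoly F[m]}) : p.@[fun=> 0] = p@_0%MM.
Proof.
rewrite [in LHS](mpolyE p) raddf_sum /=.
rewrite (eq_bigr (fun a => p@_a * (a == 0%MM)%:R)) => [|a _].
  have [p0|p0] := boolP (0%MM \in msupp p).
    rewrite (bigD1_seq 0%MM) ?msupp_uniq //= eqxx mulr1 big1 ?addr0 // => a.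
    by move=> /negbTE->; rewrite mulr0.
  rewrite (memN_msupp_eq0 p0) big_seq big1 // => a ap.
  by case: eqP => [a0|]; rewrite ?mulr0 //; rewrite a0 (negbTE p0) in ap.
rewrite mevalZ mevalX; congr (_ * _).
have [->|aN0] := eqVneq a 0%MM; first by rewrite big1 // => i _; rewrite mnm0E expr0.
have [i ai] : exists i, a i != 0%N.
  apply/existsP; apply: contraNT aN0; rewrite negb_exists => /forallP a0.
  by apply/eqP/mnmP => i; rewrite mnm0E; apply/eqP; have := a0 i; rewrite negbK.
by rewrite (bigD1 i) //= expr0n (negbTE ai) mul0r.
Qed.

(** The derivative at 0 is the coefficient times a product of factorials, which is nonzero in
    characteristic 0. *)
Lemma mderivm_at0_eq0 m (p : {mpoly F[m]}) a :
  ((p^`M[a]).@[fun=> 0] == 0) = (p@_a == 0).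
Proof.
rewrite meval_at0 mcoeff_mderivm addm0 mulrn_eq0.
suff /negbTE-> : (\prod_i (a i) ^_ (a i))%N != 0%N by [].
by rewrite -lt0n prodn_gt0 // => i; rewrite ffactnn fact_gt0.
Qed.

Lemma flat_meval m (p : {mpoly F[m]}) s (w : 'I_m -> F -> F) :
  (forall a, (mdeg a < s)%N -> p@_a = 0) -> (forall i, flat 1 (w i)) ->
  flat s (fun t => p.@[fun i => w i t]).
Proof.
move=> p0 w1; have: flat s (fun t => \sum_(a <- msupp p | a \in msupp p)
    p@_a * \prod_i w i t ^+ a i).
  apply: flat_sum => a; rewrite mcoeff_msupp => pa; apply: flatMl; first exact: polyfunC.
  have sa : (s <= mdeg a)%N by rewrite leqNgt; apply: contra pa => /p0->.
  apply: flatW sa _; rewrite mdegE.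
  by apply: flat_prod => i; have := flatX (a i) (w1 i); rewrite mul1n.
by apply: flat_ext => t; rewrite mevalE [RHS]big_seq.
Qed.

(** On the line of direction [w], the part of degree [k] contributes its value at [w] times
    [t ^+ k]; so each part of degree below [s] vanishes at every [w]. *)
Lemma mcoeff_flat m (p : {mpoly F[m]}) s :
  (forall w : 'I_m -> F, flat s (fun t => p.@[fun i => t * w i])) ->
  forall a, (mdeg a < s)%N -> p@_a = 0.
Proof.
move=> pf a sa; have [ap|/memN_msupp_eq0//] := boolP (a \in msupp p).
pose q := \sum_(b : 'X_{1..m < msize p} | mdeg b == mdeg a) p@_b *: 'X_[b].
have : q = 0.
  apply: mpoly_meval0 => w; rewrite /q raddf_sum /=.
  rewrite -[RHS](@flat_coef0 F s _ (fun b : 'X_{1..m < msize p} =>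
    p@_b * \prod_i w i ^+ b i) (fun b => mdeg b) _ _ sa).
    by apply: eq_bigr => b _; rewrite mevalZ mevalX.
  apply: flat_ext (pf w) => t; rewrite [in LHS](mpolywE (leqnn (msize p))).
  rewrite raddf_sum; apply: eq_bigr => b _; rewrite /= mevalZ mevalX -mulrA.
  congr (_ * _); rewrite mdegE expr_sum -big_split; apply: eq_bigr => i _.
  by rewrite /= mulrC exprMn.
move=> /(congr1 (mcoeff a)); rewrite mcoeff0 raddf_sum /=.
rewrite (bigD1 (BMultinom (msize_mdeg_lt ap))) //= mcoeffZ mcoeffX eqxx mulr1.
rewrite big1 ?addr0 // => b /andP[_ ba]; rewrite mcoeffZ mcoeffX.
suff /negbTE-> : val b != a by rewrite mulr0.
by apply: contraNneq ba => ba; apply/eqP/val_inj.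
Qed.

Lemma sum_scale_ffunE (J I : finType) (c : J -> F) (w : J -> {ffun I -> F^o}) i :
  (\sum_j c j *: w j) i = \sum_j c j * w j i.
Proof.
by elim/big_rec2: _ => [|j u u' _ <-]; rewrite !ffunE.
Qed.

Lemma hyperplane_span (I : finType) (h : {ffun I -> F}) (X : seq {ffun I -> F^o}) :
  (forall u : {ffun I -> F^o}, u \in X -> \sum_i h i * u i = 0) -> hyperplane_contains h <<X>>%VS.
Proof.
move=> hX u uX; rewrite (coord_span (X := in_tuple X) uX).
rewrite (eq_bigr (fun i => \sum_k coord (in_tuple X) k u * (h i * X`_k i))).
  rewrite exchange_big big1 // => k _; rewrite -mulr_sumr hX ?mulr0 //.
  exact: mem_nth.
move=> i _; rewrite sum_scale_ffunE mulr_sumr.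
by apply: eq_bigr => k _; rewrite mulrCA.
Qed.

End FlatPolynomials.

(** * Hyperplanes containing an osculating space *)

Section Osculating.
Variables (F : numFieldType) (r : nat) (n d : 'I_r.+1 -> nat).
Local Notation V := (svvar n).
Local Notation mon := (svmon n d).
Implicit Types (x y z : {ffun V -> F}) (e : mon) (h : {ffun mon -> F}).

Definition svform h x : F := \sum_e h e * svmap d x e.

Definition moved x z (t : F) : {ffun V -> F} := [ffun v => x v + t * z v].

Lemma polyfun_svform h (f : V -> F -> F) : (forall v, polyfun (f v)) ->
  polyfun (fun t => svform h [ffun v => f v t]).
Proof.
move=> pf; apply: polyfun_sum => e; apply: polyfunM; first exact: polyfunC.
have: polyfun (fun t => \prod_v f v t ^+ val e v).
  by apply: polyfun_prod => v; apply: polyfunX.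
by apply: polyfun_ext => t; rewrite ffunE; apply: eq_bigr => v _; rewrite ffunE.
Qed.

Lemma flat_svform_sub s h (f g : V -> F -> F) : (forall v, eqflat s (f v) (g v)) ->
  flat s (fun t => svform h [ffun v => f v t] - svform h [ffun v => g v t]).
Proof.
move=> fg; have: flat s (fun t => \sum_e h e *
    (\prod_v f v t ^+ val e v - \prod_v g v t ^+ val e v)).
  apply: flat_sum => e _; apply: flatMl; first exact: polyfunC.
  by have [] := @eqflat_prod F s _ (index_enum _) (fun v t => f v t ^+ val e v)
    (fun v t => g v t ^+ val e v) (fun v => eqflatX (val e v) (fg v)).
apply: flat_ext => t; rewrite -sumrB; apply: eq_bigr => e _; rewrite -mulrBr !ffunE.
by congr (_ * (_ - _)); apply: eq_bigr => v _; rewrite ffunE.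
Qed.

Lemma svform_scale (c : 'I_r.+1 -> F) h x y : (forall v, x v = c (tag v) * y v) ->
  svform h x = (\prod_i c i ^+ d i) * svform h y.
Proof.
move=> xy; rewrite /svform big_distrr /=; apply: eq_bigr => e _.
by rewrite (svmap_scale xy) mulrCA.
Qed.

Lemma hyperplane_osculatingE m s (phi : mon -> {mpoly F[m]}) h :
  hyperplane_contains h (osculating s phi) <->
  forall a, (mdeg a < s.+1)%N -> (\sum_e h e *: phi e)@_a = 0.
Proof.
have derE a : (\sum_e h e *: phi e)^`M[a].@[fun=> 0] =
    \sum_e h e * (phi e)^`M[a].@[fun=> 0].
  have -> : (\sum_e h e *: phi e)^`M[a] = \sum_e h e *: (phi e)^`M[a].
    by rewrite linear_sum; apply: eq_bigr => e _; rewrite /= mderivmZ.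
  by rewrite raddf_sum; apply: eq_bigr => e _; rewrite /= mevalZ.
split=> [hU a sa|h0 u uU].
  apply/eqP; rewrite -mderivm_at0_eq0 derE; apply/eqP.
  have := hU [ffun e => (phi e)^`M[a].@[fun=> 0]].
  rewrite (_ : _ \in _).
    move=> /(_ isT) E; rewrite -[RHS]E; apply: eq_bigr => e _; by rewrite ffunE.
  apply: memv_span; apply/imageP; by exists (BMultinom sa).
apply: hyperplane_span uU => _ /imageP[a _ ->].
rewrite (eq_bigr (fun e => h e * (phi e)^`M[a].@[fun=> 0])) => [|e _].
  by rewrite -derE; apply/eqP; rewrite mderivm_at0_eq0 h0 // bmdeg.
by rewrite ffunE.
Qed.

Section Chart.
Variables (j : forall i, 'I_(n i).+1) (x : {ffun V -> F}).
Hypothesis x1 : forall i, x (svx (j i)) = 1.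

Definition affvar (a : 'I_#|{: svaff n}|) : V :=
  svx (lift (j (tag (enum_val a))) (tagged (enum_val a))).

Lemma meval_svchart (z : V -> F) v : (forall i, z (svx (j i)) = 0) ->
  (svchart j x v).@[fun a => z (affvar a)] = x v + z v.
Proof.
move=> z0; have [[i ->]|[i [l ->]]] := svvarP j v.
  by rewrite svchart1 meval1 x1 z0 addr0.
by rewrite svchartE mevalD mevalC mevalXU /affvar enum_rankK.
Qed.

(** A direction of the chart lifted to homogeneous coordinates: it leaves the coordinates normalised
    to 1 unchanged. *)
Definition affext (w : 'I_#|{: svaff n}| -> F) (v : V) : F :=
  if unlift (j (tag v)) (tagged v) is Some l
  then w (enum_rank (Tagged (fun i => 'I_(n i)) l : svaff n)) else 0.

Lemma affext_j w i : affext w (svx (j i)) = 0.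
Proof. by rewrite /affext /= unlift_none. Qed.

Lemma affext_aff w a : affext w (affvar a) = w a.
Proof.
rewrite /affext /affvar /= liftK; congr w; rewrite -[RHS]enum_valK.
by case: (enum_val a).
Qed.

Variable phi : mon -> {mpoly F[#|{: svaff n}|]}.
Hypothesis phiE : forall e, phi e = \prod_v svchart j x v ^+ val e v.

Lemma meval_chart_svform h (z : V -> F) : (forall i, z (svx (j i)) = 0) ->
  (\sum_e h e *: phi e).@[fun a => z (affvar a)] = svform h [ffun v => x v + z v].
Proof.
move=> z0; rewrite raddf_sum; apply: eq_bigr => e _; rewrite /= mevalZ; congr (_ * _).
rewrite phiE rmorph_prod ffunE; apply: eq_bigr => v _.
by rewrite rmorphXn /= meval_svchart // ffunE.
Qed.

(* A point near [x] is brought back to the chart by dividing each block by its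
   [j]-th coordinate [1 + t * z (svx (j i))], which is a unit modulo
   [t ^+ s.+1]. *)
Lemma hyperplane_osculatingP s h :
  hyperplane_contains h (osculating s phi) <->
  forall z, flat s.+1 (fun t => svform h (moved x z t)).
Proof.
rewrite hyperplane_osculatingE; split=> [G0 z|hf]; last first.
  apply: mcoeff_flat => w; apply: flat_ext (hf (finfun (affext w))) => t.
  pose z v := t * affext w v.
  transitivity (svform h [ffun v => x v + z v]).
    by congr svform; apply/ffunP => v; rewrite !ffunE.
  rewrite -meval_chart_svform => [|i]; last by rewrite /z affext_j mulr0.
  by apply: meval_eq => a; rewrite /z affext_aff.
(* In each block [(x + t z) / (1 + t c) = x + t (z - c x) / (1 + t c)], so the division leaves a
   displacement in the direction [z'], which lies in the chart. *)
pose c i := z (svx (j i)); pose z' v := z v - c (tag v) * x v.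
have z'j i : z' (svx (j i)) = 0 by rewrite /z' x1 mulr1 subrr.
have [nu pnu nuP] := fin_all_exists2 (fun i => flat_inverse s.+1 (c i)).
have nu0 i : nu i 0 = 1 by case: (nuP i).
have flat_z' v : flat 1 (fun t => t * nu (tag v) t * z' v).
  apply: flat_ext (flatMl (polyfunM (pnu (tag v)) (polyfunC (z' v))) (flat_id F)).
  by move=> t; rewrite mulrC mulrA.
have chart_flat : flat s.+1
    (fun t => svform h [ffun v => x v + t * nu (tag v) t * z' v]).
  apply: flat_ext (flat_meval G0 (fun a => flat_z' (affvar a))) => t.
  pose z'' v := t * nu (tag v) t * z' v.
  by rewrite (@meval_chart_svform h z'') // => i; rewrite /z'' z'j mulr0.
have eq_nu v : eqflat s.+1 (fun t => nu (tag v) t * moved x z t v)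
    (fun t => x v + t * nu (tag v) t * z' v).
  have pmoved : polyfun (fun t => moved x z t v).
    have := polyfunD (polyfunC (x v)) (polyfunM (polyfun_id F) (polyfunC (z v))).
    by apply: polyfun_ext => t; rewrite ffunE.
  split; first exact: polyfunM.
    exact: polyfunD (polyfunC _) (flat_polyfun (flat_z' v)).
  have [_] := nuP (tag v); move/(flatMl (polyfunC (x v))).
  apply: flat_ext => t; rewrite ffunE /z'.
  ring.
have fl := flatD (flat_svform_sub h eq_nu) chart_flat.
(* By multihomogeneity, the division multiplies the form by this function, which is 1 at 0. *)
apply: (@flat_unit F _ (fun t => \prod_i nu i t ^+ d i)).
- by apply: polyfun_prod => i; apply: polyfunX.
- by rewrite big1 ?oner_neq0 // => i _; rewrite nu0 expr1n.
- apply: polyfun_ext (polyfun_svform h (f := fun v t => moved x z t v) _) => [t|v].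
    by congr svform; apply/ffunP => v; rewrite !ffunE.
  have := polyfunD (polyfunC (x v)) (polyfunM (polyfun_id F) (polyfunC (z v))).
  by apply: polyfun_ext => t; rewrite ffunE.
apply: flat_ext fl => t; rewrite subrK; apply: svform_scale => v.
by rewrite ffunE.
Qed.

End Chart.
End Osculating.

(** * Linear systems spanned by monomials and their singular members *)

Section MonomialSystem.
Variables (F : numFieldType) (r : nat) (n d : 'I_r.+1 -> nat).
Local Notation V := (svvar n).
Local Notation mon := (svmon n d).
Implicit Types (x y z : {ffun V -> F}) (e : mon) (h : {ffun mon -> F}).

(** Multiplicity tested on the lines of the space of homogeneous coordinates. By
    [hyperplane_osculatingP], at a normalised [x] and for [s > 0], it says that [h] contains the
    osculating space of order [s - 1]. *)
Definition mult_ge s h x : Prop := forall z, flat s (fun t => svform h (moved x z t)).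

Definition svpos (v : V) : nat := tagged v.

Definition coordpt (k : nat) : {ffun V -> F} := [ffun v => (svpos v == k)%:R].

Definition offdeg (k : nat) e : nat := (\sum_(v : V | svpos v != k) svexp e v)%N.

Definition offexp (k : nat) e (v : V) : nat :=
  if svpos v == k then 0%N else svexp e v.

Lemma offdegE k e : offdeg k e = (\sum_v offexp k e v)%N.
Proof. by rewrite /offdeg big_mkcond; apply: eq_bigr => v _; rewrite if_neg. Qed.

Lemma offexp_inj k e e' : offexp k e =1 offexp k e' -> e = e'.
Proof.
move=> ee'; apply: svmon_inj => -[i l].
have off (m : 'I_(n i).+1) : m != k :> nat -> svexp e (svx m) = svexp e' (svx m).
  by move=> /negbTE mk; have := ee' (svx m); rewrite /offexp /svpos /= mk.
have [lk|/off//] := eqVneq (l : nat) k.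
have eS (e1 : mon) : (svexp e1 (svx l) + \sum_(m < (n i).+1 | m != l) svexp e1 (svx m) = d i)%N.
  by rewrite -[RHS](svmonE e1 i) [RHS](bigD1 l).
have := etrans (eS e) (esym (eS e')).
rewrite (eq_bigr (fun m => svexp e' (svx m))); first exact: addIn.
by move=> m ml; apply: off; rewrite -lk.
Qed.

(** The order of a monomial [e] at [coordpt k] is [offdeg k e]. On lines that keep the [k]-th
    coordinates at 1, distinct monomials stay distinct by [offexp_inj], so no cancellation can raise
    the order of a form. *)
Lemma mult_coordptP s k h :
  mult_ge s h (coordpt k) <-> forall e, h e != 0 -> (s <= offdeg k e)%N.
Proof.
split=> [hf e he|hs z]; last first.
  apply: flat_sum => e _; have [->|/hs se] := eqVneq (h e) 0.
    by apply: flat_ext (flat0 F s) => t; rewrite mul0r.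
  apply: flatMl; first exact: polyfunC.
  have pm v : polyfun (fun t => moved (coordpt k) z t v).
    have := polyfunD (polyfunC (coordpt k v)) (polyfunM (polyfun_id F) (polyfunC (z v))).
    by apply: polyfun_ext => t; rewrite [in RHS]ffunE.
  apply: flatW se _; rewrite offdegE.
  apply: flat_ext (flat_prod _ (f := fun v t => moved (coordpt k) z t v ^+ svexp e v) _).
    by move=> t; rewrite svmapE.
  move=> v; rewrite /offexp; case: ifPn => vk.
    exact/polyfun_flat0/polyfunX.
  have := flatX (svexp e v) (flatMl (polyfunC (z v)) (flat_id F)); rewrite mul1n.
  by apply: flat_ext => t; rewrite !ffunE (negbTE vk) add0r mulrC.
rewrite leqNgt; apply: contra he => es; apply/eqP.
pose a e' := if offdeg k e' == offdeg k e then h e' else 0.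
have -> : h e = a e by rewrite /a eqxx.
apply: (@monomials_free F _ _ a (offexp k)) => [e1 e2|y]; first exact: offexp_inj.
pose z : {ffun V -> F} := [ffun v => if svpos v == k then 0 else y v].
have fl : flat s (fun t => \sum_e' h e' * \prod_v y v ^+ offexp k e' v * t ^+ offdeg k e').
  apply: flat_ext (hf z) => t; apply: eq_bigr => e' _; rewrite -mulrA; congr (_ * _).
  rewrite svmapE offdegE expr_sum -big_split; apply: eq_bigr => v _ /=.
  rewrite !ffunE /offexp; case: ifP => vk; last by rewrite add0r exprMn mulrC.
  by rewrite mulr0 addr0 expr1n expr0 mulr1.
rewrite -[RHS](flat_coef0 fl es) [RHS]big_mkcond; apply: eq_bigr => e' _.
by rewrite /a; case: ifP; rewrite ?mul0r.
Qed.

(** Replacing [y v0] by [y v0 * (1 + t)] multiplies the monomial [e] by [(1 + t) ^+ svexp e v0]; the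
    two sums are the value and the derivative at [t = 0]. *)
Lemma mult2_torus h y : mult_ge 2 h y ->
  \sum_e h e * svmap d y e = 0 /\
  forall v, \sum_e h e * svmap d y e * (svexp e v)%:R = 0.
Proof.
move=> hf; suff key v0 : \sum_e h e * svmap d y e = 0 /\
    \sum_e h e * svmap d y e * (svexp e v0)%:R = 0.
  by split=> [|v]; [case: (key (svx (ord0 : 'I_(n ord0).+1)))|case: (key v)].
pose z : {ffun V -> F} := [ffun v => if v == v0 then y v0 else 0].
have svE e t : svmap d (moved y z t) e = svmap d y e * (1 + t) ^+ svexp e v0.
  have -> : (1 + t) ^+ svexp e v0 = \prod_v (if v == v0 then 1 + t else 1) ^+ svexp e v.
    by rewrite (bigD1 v0) //= eqxx big1 ?mulr1 // => v /negbTE->; rewrite expr1n.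
  rewrite !svmapE -big_split; apply: eq_bigr => v _ /=.
  rewrite -exprMn; congr (_ ^+ _); rewrite ffunE [z v]ffunE.
  by case: eqP => [->|]; rewrite ?mulr0 ?addr0 ?mulr1 // mulrDr mulr1 mulrC.
pose p : {poly F} := \sum_e (h e * svmap d y e) *: ('X + 1) ^+ svexp e v0.
have [g [u gu] fg] := hf z.
have pE : p = 'X^2 * u.
  apply/eqP; rewrite -subr_eq0; apply/eqP/poly_horner0 => t.
  rewrite hornerD hornerN hornerM hornerXn -gu -fg; apply/eqP; rewrite subr_eq0.
  rewrite horner_sum; apply/eqP; apply: eq_bigr => e _.
  by rewrite hornerZ horner_exp hornerD hornerX hornerC svE -mulrA [t + 1]addrC.
split.
  transitivity p.[0]; last by rewrite pE hornerM hornerXn expr0n mul0r.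
  rewrite horner_sum; apply: eq_bigr => e _.
  by rewrite hornerZ horner_exp hornerD hornerX hornerC add0r expr1n mulr1.
transitivity p^`().[0]; last first.
  rewrite pE derivM derivXn hornerD !hornerM hornerMn !hornerXn.
  by rewrite !expr0n mul0rn !mul0r addr0.
rewrite [p^`()]linear_sum horner_sum /=; apply: eq_bigr => e _.
rewrite derivZ hornerZ; congr (_ * _).
rewrite deriv_exp derivD derivX derivC addr0 mul1r hornerMn horner_exp.
by rewrite hornerD hornerX hornerC add0r expr1n.
Qed.


Lemma svexp_neq0 e v x : svmap d x e != 0 -> svexp e v != 0%N -> x v != 0.
Proof.
rewrite svmapE => xe ev; apply: contraNneq xe => xv.
by apply/prodf_eq0; exists v; rewrite // xv expr0n (negbTE ev).
Qed.

(** When [S] is the support of [y], these are the monomials of [M] that do not vanish at [y]. *)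
Definition in_support (M : {set mon}) (S : {set V}) : {set mon} :=
  [set e in M | [forall v, (svexp e v != 0%N) ==> (v \in S)]].

Lemma singular_discriminant (M : {set mon}) (S : {set V}) :
  in_support M S != set0 -> exists k, exists P : {mpoly F[#|{: mon}|]},
  [/\ P \is k.-homog, P != 0,
      forall h h', {in M, h =1 h'} ->
        P.@[fun i => h (enum_val i)] = P.@[fun i => h' (enum_val i)]
    & forall h y, (forall e, h e != 0 -> e \in M) -> mult_ge 2 h y ->
        S = [set v | y v != 0] -> P.@[fun i => h (enum_val i)] = 0].
Proof.
move=> /(discriminant F (@svexp r n d))[k [P [Phom PN0 PE P0]]]; exists k, P; split=> //.
  by move=> h h' hh'; apply: PE => e; rewrite inE => /andP[/hh'].
move=> h y hM hy SE.
(* The value 1 off the support keeps [w] nowhere zero; the monomials of [in_support M S] have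
   exponent 0 there. *)
pose w v := if y v == 0 then 1 else (y v)^-1.
pose c e := h e * svmap d y e.
have sumE (G : mon -> F) : (forall e, c e = 0 -> G e = 0) ->
    \sum_(e in in_support M S) G e = \sum_e G e.
  move=> G0; rewrite big_mkcond; apply: eq_bigr => e _.
  case: ifPn => // eN; apply/esym/G0/eqP; apply: contraNT eN; rewrite mulf_eq0.
  rewrite negb_or => /andP[/hM eM ye]; rewrite inE eM; apply/forallP => v.
  by apply/implyP => ev; rewrite SE inE; apply: svexp_neq0 ye ev.
have [c0 cv] := mult2_torus hy.
rewrite -[RHS](P0 c w).
- apply: (PE h (fun e => c e * \prod_v w v ^+ svexp e v)) => e.
  rewrite inE => /andP[_ /forallP eS].
  rewrite /c svmapE -mulrA -big_split /=.
  suff -> : \prod_v (y v ^+ svexp e v * w v ^+ svexp e v) = 1 by rewrite mulr1.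
  apply: big1 => v _.
  rewrite -exprMn /w; case: eqP => [yv|/eqP yv]; last by rewrite divff ?expr1n.
  suff /eqP-> : svexp e v == 0%N by rewrite expr0.
  by apply: contraLR (eS v) => ev; rewrite ev SE inE yv eqxx.
- by move=> v; rewrite /w; case: ifPn => [_|]; rewrite ?oner_neq0 ?invr_eq0.
- by rewrite sumE.
- by move=> v; rewrite sumE // => e ->; rewrite mul0r.
Qed.

(** The product of one polynomial per support [S]. Each factor sees only the coefficients in [M], so
    a vector where the product is nonzero can be truncated to [M]. *)
Lemma generic_smooth (M : {set mon}) : exists k, exists P : {mpoly F[#|{: mon}|]},
  [/\ P \is k.-homog,
      exists2 h : {ffun mon -> F}, (forall e, h e != 0 -> e \in M) &
        P.@[fun i => h (enum_val i)] != 0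
    & forall h y, (forall e, h e != 0 -> e \in M) ->
        P.@[fun i => h (enum_val i)] != 0 -> mult_ge 2 h y ->
        forall e, e \in M -> svmap d y e = 0].
Proof.
have /fin_all_exists[kP kPP] : forall S, exists kP : nat * {mpoly F[#|{: mon}|]},
    [/\ kP.2 \is (kP.1).-homog, kP.2 != 0,
      forall h h', {in M, h =1 h'} ->
        kP.2.@[fun i => h (enum_val i)] = kP.2.@[fun i => h' (enum_val i)]
    & forall h y, (forall e, h e != 0 -> e \in M) -> mult_ge 2 h y ->
        S = [set v | y v != 0] -> in_support M S != set0 ->
        kP.2.@[fun i => h (enum_val i)] = 0].
  move=> S; have [E0|/singular_discriminant[k [P [Ph PN0 PE P0]]]] :=
      eqVneq (in_support M S) set0; last first.
    by exists (k, P); split=> // h y hM hy SE _; apply: P0 hy SE.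
  (* Every monomial of [M] vanishes at the points with this support: they lie in the base locus and
     impose no condition. *)
  exists (0%N, 1); split=> [||h h' _|h y _ _ _].
  - by rewrite /= dhomog1.
  - by rewrite /= oner_neq0.
  - by rewrite /= !meval1.
  - by [].
exists (\sum_S (kP S).1)%N, (\prod_S (kP S).2); split.
- by apply: dhomog_bigprod => S; case: (kPP S).
- have PN0 : \prod_S (kP S).2 != 0 by apply/prodf_neq0 => S _; case: (kPP S).
  have [pt xN0] : exists pt, (\prod_S (kP S).2).@[pt] != 0.
    apply: contrapT => /forallNP x0; case/negP: PN0; apply/eqP/mpoly_meval0 => pt.
    by apply/eqP/negPn/negP/x0.
  pose h : {ffun mon -> F} := [ffun e => if e \in M then pt (enum_rank e) else 0].
  exists h => [e|]; first by rewrite ffunE; case: ifP; rewrite ?eqxx.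
  move: xN0; rewrite !rmorph_prod => /prodf_neq0 xN0; apply/prodf_neq0 => S _.
  have [_ _ PE _] := kPP S; have := xN0 S isT; rewrite /=.
  rewrite (PE h [ffun e => pt (enum_rank e)]) => [|e eM]; last by rewrite !ffunE eM.
  by congr (_ != 0); apply: meval_eq => i; rewrite ffunE enum_valK.
move=> h y hM hN0 hy e eM; apply/eqP; apply: contraNT hN0 => ye.
pose S := [set v | y v != 0]; have [_ _ _ P0] := kPP S.
rewrite rmorph_prod; apply/prodf_eq0; exists S => //=; apply/eqP.
apply: P0 (hM) (hy) (erefl _) _; apply/set0Pn; exists e.
rewrite inE eM; apply/forallP => v; apply/implyP => ev.
by rewrite inE; apply: svexp_neq0 ye ev.
Qed.

End MonomialSystem.

(** * The base locus of the system *)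

Section BaseLocus.
Variables (F : numFieldType) (r : nat) (n d : 'I_r.+1 -> nat).
Hypothesis d_gt0 : forall i, (0 < d i)%N.
Local Notation V := (svvar n).
Local Notation mon := (svmon n d).
Local Notation hblocks := (hpoint (fun v : V => tag v)).
Implicit Types (x y z : {ffun V -> F}) (e : mon) (h : {ffun mon -> F}).
Implicit Types (l : forall i, 'I_(n i).+1).

Lemma power_mon l : exists e, forall v,
  svexp e v = if v == svx (l (tag v)) then d (tag v) else 0%N.
Proof.
apply: (@svmon_exists _ _ _ (fun v : V => if v == svx (l (tag v)) then d (tag v) else 0%N)).
move=> i; rewrite (bigD1 (l i)) //= eqxx big1 ?addn0 // => m ml.
by rewrite /svx eq_Tagged /= (negbTE ml).
Qed.

Lemma hblocksP x : hblocks x -> exists l, forall i, x (svx (l i)) != 0.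
Proof.
move=> hx; have /fin_all_exists[l lP] : forall i, exists m : 'I_(n i).+1, x (svx m) != 0.
  by move=> i; have [[j m] /= ji xm] := hx i; case: i / ji; exists m.
by exists l.
Qed.

Lemma svmap_power x l e : (forall i, x (svx (l i)) != 0) ->
  (forall v, svexp e v = if v == svx (l (tag v)) then d (tag v) else 0%N) ->
  svmap d x e != 0.
Proof.
move=> xl eE; rewrite svmapE; apply/prodf_neq0 => -[i m] _; rewrite eE /=.
by case: ifP => [/eqP->|_]; rewrite ?expr0 ?oner_neq0 // expf_neq0.
Qed.

Lemma svmap_neq0 x : hblocks x -> exists e, svmap d x e != 0.
Proof.
by move=> /hblocksP[l xl]; have [e eE] := power_mon l; exists e; apply: svmap_power eE.
Qed.

Variable D : nat.
Hypothesis D_le : forall i, (D <= d i)%N.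
Hypothesis D_attained : exists i, D = d i.

Definition mult_mon : {set mon} :=
  [set e | [forall k : 'I_(n ord0).+1, (D <= offdeg k e)%N]].

Lemma offdeg_power (k : nat) l e i :
  (forall v, svexp e v = if v == svx (l (tag v)) then d (tag v) else 0%N) ->
  l i != k :> nat -> (D <= offdeg k e)%N.
Proof.
move=> eE lk; apply: leq_trans (D_le i) _.
by rewrite /offdeg (bigD1 (svx (l i))) //= eE eqxx leq_addr.
Qed.

(** If [y] is nonzero at all [svx (l i)], the product of the pure powers along [l] is nonzero at
    [y], hence not in [mult_mon], which forces [l] to be constant. With two factors, altering one
    entry of [l] and keeping another shows that a single index is possible. *)
Lemma base_locus y : mult_mon != set0 -> hblocks y ->
  (forall e, e \in mult_mon -> svmap d y e = 0) ->
  exists k : 'I_(n ord0).+1, forall v, y v != 0 -> svpos v = k.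
Proof.
move=> /set0Pn[e0 e0M] /hblocksP[l0 yl0] yM.
have const l : (forall i, y (svx (l i)) != 0) ->
    exists k : 'I_(n ord0).+1, forall i, l i = k :> nat.
  move=> yl; have [e eE] := power_mon l.
  have : e \notin mult_mon by apply/negP => /yM/eqP; apply/negP/(svmap_power yl eE).
  rewrite inE negb_forall => /existsP[k kD]; exists k => i; apply/eqP.
  by apply: contraNT kD; apply: offdeg_power.
have [k0 l0k] := const l0 yl0; exists k0 => -[i m] ym; rewrite /svpos /=.
have [[i' i'i]|single] := pselect (exists i', i' != i); last first.
  have all0 (i' : 'I_r.+1) : i' = ord0.
    have alli (i'' : 'I_r.+1) : i'' = i by apply/eqP/negPn/negP => i'i; apply: single; exists i''.
    exact: etrans (alli i') (esym (alli ord0)).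
  have [i1 D1] := D_attained; rewrite (all0 i1) in D1.
  (* With a single factor, [e0] has total degree [D], so its order is below [D] at the coordinate
     point of any variable that it contains. *)
  have : (\sum_(l < (n ord0).+1) svexp e0 (svx l) != 0)%N by rewrite svmonE -lt0n.
  rewrite sum_nat_eq0 negb_forall => /existsP[l /= el].
  move: e0M; rewrite inE => /forallP/(_ l); rewrite leqNgt => /negP[].
  have -> : D = (\sum_v svexp e0 v)%N.
    rewrite svsum (bigD1 ord0) //= svmonE D1 big1 ?addn0 // => i' /eqP[].
    exact: all0.
  rewrite [X in (_ < X)%N](bigID (fun v : V => svpos v != l)) /=.
  rewrite -[X in (X < _)%N]addn0 ltn_add2l (bigD1 (svx l)) ?negbK ?ltn_addr //.
  by rewrite lt0n.
pose l1 := dfwith l0 m.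
have yl1 i2 : y (svx (l1 i2)) != 0.
  by rewrite /l1; case: dfwithP.
have [k1 l1k] := const l1 yl1.
have k10 : k1 = k0 :> nat.
  by rewrite -(l1k i') -(l0k i') /l1 dfwith_out // eq_sym.
by rewrite -k10 -(l1k i) /l1 dfwith_in.
Qed.

End BaseLocus.

(** * General hyperplanes in an arbitrary frame *)

Lemma homog_substitution (F : numFieldType) (J : finType) (C : J -> J -> F) k
    (P : {mpoly F[#|J|]}) : P \is k.-homog -> exists2 Q : {mpoly F[#|J|]},
  Q \is k.-homog & forall h : {ffun J -> F},
    hpeval Q h = hpeval P [ffun j' => \sum_j h j * C j j'].
Proof.
move=> Phom.
pose L (i : 'I_#|J|) : {mpoly F[#|J|]} := \sum_j C j (enum_val i) *: 'X_(enum_rank j).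
exists (\sum_(a <- msupp P) P@_a *: \prod_i L i ^+ a i) => [|h].
  rewrite big_seq; apply: rpred_sum => a aP; apply: rpredZ.
  rewrite -(dhomog_mf Phom aP) /= mdegE.
  apply: dhomog_bigprod => i; rewrite -[X in X.-homog]mul1n; apply: dhomogMn.
  by apply: rpred_sum => e _; apply: rpredZ; rewrite dhomogX /= mdeg1.
rewrite /hpeval [in RHS]mevalE raddf_sum; apply: eq_bigr => a _.
rewrite /= mevalZ; congr (_ * _); rewrite rmorph_prod; apply: eq_bigr => i _.
rewrite rmorphXn; congr (_ ^+ _); rewrite ffunE raddf_sum; apply: eq_bigr => e _.
by rewrite /= mevalZ mevalXU enum_rankK mulrC.
Qed.

Section GenericHyperplane.
Variables (F : numFieldType) (r : nat) (n d : 'I_r.+1 -> nat).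
Hypothesis d_gt0 : forall i, (0 < d i)%N.
Hypothesis n_ge : forall i, (n ord0 <= n i)%N.
Local Notation V := (svvar n).
Local Notation mon := (svmon n d).
Local Notation hblocks := (hpoint (fun v : V => tag v)).
Implicit Types (x y z : {ffun V -> F}) (e : mon) (h : {ffun mon -> F}).
Implicit Types (g : forall i, 'M[F]_((n i).+1)).
Variable D : nat.
Hypothesis D_le : forall i, (D <= d i)%N.
Hypothesis D_attained : exists i, D = d i.

(** The dual action: if [C] represents [blockact g], the form of [pull C h] is that of [h] composed
    with [blockact g]. *)
Definition pull (C : mon -> mon -> F) h : {ffun mon -> F} :=
  [ffun e' => \sum_e h e * C e e'].

Lemma pullE C g h x :
  (forall x e, svmap d (blockact g x) e = \sum_e' C e e' * svmap d x e') ->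
  svform h (blockact g x) = svform (pull C h) x.
Proof.
move=> CP; rewrite /svform (eq_bigr (fun e => \sum_e' h e * C e e' * svmap d x e')).
  rewrite exchange_big; apply: eq_bigr => e' _ /=.
  by rewrite [pull _ _ _]ffunE big_distrl.
move=> e _; rewrite CP big_distrr; apply: eq_bigr => e' _; exact: mulrA.
Qed.

Lemma blockact_moved g x z t :
  blockact g (moved x z t) = moved (blockact g x) (blockact g z) t.
Proof.
apply/ffunP => v; rewrite !ffunE big_distrr -big_split /=; apply: eq_bigr => l _.
by rewrite ffunE mulrDr mulrCA.
Qed.

Lemma blockactM g g' x :
  blockact g (blockact g' x) = blockact (fun i => g i *m g' i) x.
Proof.
apply/ffunP => v; rewrite !ffunE.
rewrite (eq_bigr (fun l => \sum_l' g (tag v) (tagged v) l * g' (tag v) l l' * x (svx l'))).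
  rewrite exchange_big; apply: eq_bigr => l' _ /=.
  by rewrite mxE big_distrl.
move=> l _; rewrite ffunE big_distrr; apply: eq_bigr => l' _; exact: mulrA.
Qed.

Lemma blockact1 g x : (forall i, g i = 1%:M) -> blockact g x = x.
Proof.
move=> g1; apply/ffunP => -[i l]; rewrite ffunE /= (bigD1 l) //= g1 mxE eqxx mul1r.
by rewrite big1 ?addr0 // => l' ll'; rewrite mxE eq_sym (negbTE ll') mul0r.
Qed.

Lemma mult_blockact g g' C s h x :
  (forall x e, svmap d (blockact g x) e = \sum_e' C e e' * svmap d x e') ->
  (forall x, blockact g (blockact g' x) = x) ->
  mult_ge s h (blockact g x) <-> mult_ge s (pull C h) x.
Proof.
move=> CP gg'; split=> hx z.
  by apply: flat_ext (hx (blockact g z)) => t; rewrite -blockact_moved (pullE _ _ CP).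
apply: flat_ext (hx (blockact g' z)) => t.
by rewrite -(pullE _ _ CP) blockact_moved gg'.
Qed.

(** [generic_smooth] and [base_locus] carried to the frame [g]: the polynomial is composed with
    [pull C], and the inverse frame supplies a hyperplane where it is nonzero. *)
Lemma generic_hyperplane g : (forall i, g i \in unitmx) ->
  exists k, exists P : {mpoly F[#|{: mon}|]},
  [/\ P \is k.-homog,
      exists2 h, hpeval P h != 0 &
        forall m : 'I_(n ord0).+1, mult_ge D h (blockact g (coordpt F n m))
    & forall h x, (exists e, h e != 0) -> hblocks x ->
        (forall m : 'I_(n ord0).+1, mult_ge D h (blockact g (coordpt F n m))) ->
        hpeval P h != 0 -> mult_ge 2 h x ->
        exists (m : 'I_(n ord0).+1) (c : 'I_r.+1 -> F),
          forall v, x v = c (tag v) * blockact g (coordpt F n m) v].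
Proof.
move=> gU; pose g' i := invmx (g i).
have gg' x : blockact g (blockact g' x) = x.
  by rewrite blockactM blockact1 // => i; rewrite mulmxV.
have g'g x : blockact g' (blockact g x) = x.
  by rewrite blockactM blockact1 // => i; rewrite mulVmx.
have [C CP] := svmap_blockact d g; have [C' C'P] := svmap_blockact d g'.
have CC' h : pull C (pull C' h) = h.
  apply/ffunP => e; apply/eqP; rewrite -subr_eq0; apply/eqP.
  pose a e := pull C (pull C' h) e - h e; rewrite -[LHS]/(a e).
  apply: svmap_free => x.
  rewrite (eq_bigr (fun e => pull C (pull C' h) e * svmap d x e - h e * svmap d x e)).
    rewrite sumrB -/(svform _ _) -/(svform h x) -(pullE _ _ CP) -(pullE _ _ C'P).
    by rewrite g'g subrr.
  by move=> e1 _; rewrite /a mulrBl.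
have multM h : (forall m : 'I_(n ord0).+1, mult_ge D h (blockact g (coordpt F n m))) <->
    forall e, pull C h e != 0 -> e \in mult_mon n d D.
  split=> [hm e he|hM m].
    rewrite inE; apply/forallP => m.
    by have /(mult_blockact _ _ _ CP gg')/mult_coordptP := hm m; apply.
  apply/(mult_blockact _ _ _ CP gg')/mult_coordptP => e /hM.
  by rewrite inE => /forallP.
have [k [P [Phom [h1 h1M Ph1] PP]]] := generic_smooth F (mult_mon n d D).
have [Q Qhom QC] := homog_substitution C Phom.
have QE h : hpeval Q h = hpeval P (pull C h) by apply: QC.
exists k, Q; split.
- exact: Qhom.
- exists (pull C' h1); first by rewrite QE CC'.
  by apply/multM => e; rewrite CC'; apply: h1M.
move=> h x [e0 he0] hx /multM hM; rewrite QE => hN0 h2.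
pose y := blockact g' x.
have xE : x = blockact g y by rewrite /y gg'.
have hy : hblocks y.
  move=> i; have [[j m] /= ji xm] := hx i; case: i / ji.
  have [m' ym'] : exists m' : 'I_(n j).+1, y (svx m') != 0.
    apply/existsP; apply: contraNT xm; rewrite negb_exists => /forallP y0.
    rewrite xE ffunE big1 // => m' _; have := y0 m'; rewrite negbK => /eqP->.
    by rewrite mulr0.
  by exists (svx m').
have y2 : mult_ge 2 (pull C h) y by apply/(mult_blockact _ _ _ CP gg'); rewrite -xE.
have yM := PP _ _ hM hN0 y2.
have MN0 : mult_mon n d D != set0.
  have [e pe] : exists e, pull C h e != 0.
    apply: contrapT => /forallNP p0; case/negP: he0; apply/eqP.
    apply: (svmap_free (h := h)) => z.
    rewrite -/(svform h z) -(gg' z) (pullE _ _ CP) /svform big1 // => e _.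
    by have /negP/negPn/eqP-> := p0 e; rewrite mul0r.
  by apply/set0Pn; exists e; apply: hM.
have [m ym] := base_locus d_gt0 D_le D_attained MN0 hy yM.
(* The index [m] exists in every factor because [n ord0] is the least of the [n i]. *)
have lt_m i : (m < (n i).+1)%N by rewrite (leq_trans (ltn_ord m)) // ltnS.
exists m, (fun i => y (svx (Ordinal (lt_m i)))) => v.
rewrite {1}xE [LHS]ffunE [blockact g (coordpt _ _ _) v]ffunE big_distrr.
apply: eq_bigr => l _ /=; rewrite mulrCA; congr (_ * _).
rewrite [coordpt _ _ _ _]ffunE /svpos /=.
have [lm|lm] := eqVneq (l : nat) m; last first.
  by rewrite mulr0; apply/eqP; apply: contraNT lm => /ym/eqP.
by rewrite mulr1; congr (y (svx _)); apply/val_inj.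
Qed.

End GenericHyperplane.

(** * Closed sets: dimension of finite sets and density in linear systems *)

Section ZariskiClosed.
Variables (F : numFieldType) (V K : finType) (b : V -> K).

Lemma zclosed_zeros (p : {mpoly F[#|V|]}) : multihomog b p ->
  zclosed b (fun x => hpoint b x /\ hpeval p x = 0).
Proof.
move=> ph; exists (eq p) => [_ <- //|x]; split=> -[xP px]; split=> //.
  by move=> _ <-.
exact: px.
Qed.

End ZariskiClosed.

Section ProjectiveSpace.
Variables (F : numFieldType) (I : finType).
Local Notation tt1 := (fun _ : I => tt).

Lemma homog_multihomog k (p : {mpoly F[#|I|]}) : p \is k.-homog -> multihomog tt1 p.
Proof.
move=> /dhomogP ph; exists (fun=> k) => m mp u; rewrite -(ph _ mp) /= mdegE.
rewrite (reindex (@enum_rank I)) /=; last exact/onW_bij/enum_rank_bij.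
by apply: eq_bigl => v; case: u.
Qed.

Lemma zclosed_proj_eq (Z : {ffun I -> F} -> Prop) w w' :
  zclosed tt1 Z -> proj_eq w w' -> Z w' -> Z w.
Proof.
case=> S Sh ZE [c c0 ww'] /ZE [hw' Sw']; apply/ZE; split.
  by move=> u; have [v vu w'v] := hw' u; exists v; rewrite // ww' mulf_neq0.
move=> p pS; have [e pe] := Sh p pS.
have -> : hpeval p w = c ^+ e tt * hpeval p w'; last by rewrite Sw' ?mulr0.
rewrite /hpeval !mevalE big_distrr /= !big_seq; apply: eq_bigr => m mp.
rewrite mulrCA; congr (_ * _).
have -> : c ^+ e tt = \prod_i c ^+ m i.
  rewrite -(pe m mp tt) expr_sum (reindex (@enum_rank I)) /=.
    by apply: eq_bigl.
  exact/onW_bij/enum_rank_bij.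
by rewrite -big_split; apply: eq_bigr => i _; rewrite ww' exprMn.
Qed.

Lemma proj_neq_minor (w w' : {ffun I -> F}) :
  (exists i, w i != 0) -> (exists i, w' i != 0) -> ~ proj_eq w w' ->
  exists i j, w i * w' j - w j * w' i != 0.
Proof.
move=> [i wi] [j0 wj0] Nww'; apply: contrapT => minor0.
have eq0 j : w i * w' j = w j * w' i.
  apply/eqP; rewrite -subr_eq0; apply/negPn/negP => N; apply: minor0.
  by exists i, j.
have w'i : w' i != 0.
  apply: contraNneq wj0 => w'i; have /eqP := eq0 j0.
  by rewrite w'i mulr0 mulf_eq0 (negbTE wi).
apply: Nww'; exists (w i / w' i); first by rewrite mulf_neq0 ?invr_eq0.
by move=> j; rewrite mulrAC eq0 mulfK.
Qed.

(** In a chain from [Z 0] to [Z 1], take [w0] in [Z 0] and a product of linear forms that vanishes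
    at all other points but not at [w0]. Its zeros and [Z 0] cover [Z 1]; irreducibility then
    contradicts either the strict inclusion or the choice of the product. *)
Lemma finite_zdim_lt1 (A : finType) (pts : A -> {ffun I -> F})
    (Y : {ffun I -> F} -> Prop) :
  (forall a, exists i, pts a i != 0) ->
  (forall w, Y w -> exists a, proj_eq w (pts a)) ->
  ~ zdim_ge tt1 1 Y.
Proof.
move=> ptsN0 Ypts [Z [Zvar Zlt ZY]].
have [Z0closed [[w0 Z0w0] _]] := Zvar 0%N isT.
have [Z1closed [_ Z1irr]] := Zvar 1%N isT.
have [Z01 [w1 Z1w1 Z0w1]] := Zlt 0%N isT.
have w0N0 : exists i, w0 i != 0.
  have [S _ /(_ w0)[/(_ Z0w0)[/(_ tt)[i _ w0i] _] _]] := Z0closed.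
  by exists i.
have /fin_all_exists[ij ijP] : forall a, exists ij : I * I, ~ proj_eq w0 (pts a) ->
    w0 ij.1 * pts a ij.2 - w0 ij.2 * pts a ij.1 != 0.
  move=> a; have [aP|aN] := pselect (proj_eq w0 (pts a)).
    by have [i _] := w0N0; exists (i, i).
  by have [i [j ijN0]] := proj_neq_minor w0N0 (ptsN0 a) aN; exists (i, j).
(* A 2 x 2 minor of a variable point and [pts a]: zero at [pts a], and nonzero at [w0] by the choice
   of [ij] if the two points differ. *)
pose l a : {mpoly F[#|I|]} := pts a (ij a).2 *: 'X_(enum_rank (ij a).1)
  - pts a (ij a).1 *: 'X_(enum_rank (ij a).2).
have lE a w : hpeval (l a) w = w (ij a).1 * pts a (ij a).2 - w (ij a).2 * pts a (ij a).1.
  by rewrite /hpeval mevalB !mevalZ !mevalXU !enum_rankK ![pts a _ * _]mulrC.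
pose p := \prod_a (if pselect (proj_eq w0 (pts a)) then 1 else l a).
have ph : multihomog tt1 p.
  pose e a := if pselect (proj_eq w0 (pts a)) then 0%N else 1%N.
  apply: (@homog_multihomog (\sum_a e a)).
  apply: (@dhomog_bigprod F _ _ _ e) => a; rewrite /e; case: pselect => ? /=; first exact: dhomog1.
  by apply: rpredB; apply: rpredZ; rewrite dhomogX /= mdeg1.
have pE w : hpeval p w = \prod_a (if pselect (proj_eq w0 (pts a)) then 1 else hpeval (l a) w).
  rewrite /hpeval rmorph_prod; apply: eq_bigr => a _; case: pselect => ? //=.
  exact: meval1.
have Zhp w : Z 1%N w -> hpoint tt1 w.
  by move=> Zw; have [S _ /(_ w)[/(_ Zw)[]]] := Z1closed.
have cover w : Z 1%N w -> Z 0%N w \/ hpoint tt1 w /\ hpeval p w = 0.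
  move=> Z1w; have [a wa] := Ypts w (ZY w Z1w).
  have [w0a|w0a] := pselect (proj_eq w0 (pts a)).
    left; apply: zclosed_proj_eq Z0closed _ Z0w0.
    have [c c0 wE] := wa; have [c' c'0 w0E] := w0a.
    exists (c / c'); first by rewrite mulf_neq0 ?invr_eq0.
    by move=> i; rewrite wE w0E mulrA divfK.
  right; split; first exact: Zhp.
  apply/eqP; rewrite pE; apply/prodf_eq0; exists a => //.
  case: pselect => //= ?; have [c _ wE] := wa; rewrite lE !wE.
  by rewrite -!mulrA [pts a (ij a).2 * _]mulrC subrr.
have [Z10|Z1p] := Z1irr _ _ Z0closed (zclosed_zeros ph) cover.
  by apply/Z0w1/Z10.
have [_ /eqP] := Z1p w0 (Z01 _ Z0w0); rewrite pE; apply/negP/prodf_neq0 => a _.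
by case: pselect => [?|/ijP] /=; rewrite ?oner_neq0 // lE.
Qed.

Lemma hyperplane_contains_sum (A : finType) (T : A -> {vspace {ffun I -> F^o}}) h :
  hyperplane_contains h (\sum_a T a)%VS <-> forall a, hyperplane_contains h (T a).
Proof.
split=> [hT a u uT|hT _ /memv_sumP[vs vsT ->]].
  by apply: hT; apply: subvP uT; apply: sumv_sup (subvv _).
have -> : \sum_a vs a = \sum_a 1 *: vs a by apply: eq_bigr => a _; rewrite scale1r.
rewrite (eq_bigr (fun i => \sum_a h i * vs a i)) => [|i _].
  by rewrite exchange_big big1 // => a _; apply: hT; apply: vsT.
rewrite sum_scale_ffunE big_distrr; apply: eq_bigr => a _.
by rewrite /= mul1r.
Qed.

(* Density is checked on the line joining a given point of [X] to [h1]. *)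
Lemma for_general_linear (X P : {ffun I -> F} -> Prop) k (p : {mpoly F[#|I|]}) h1 :
  p \is k.-homog -> hpeval p h1 != 0 ->
  (forall h h' t, X h -> X h' -> X [ffun i => h i + t * (h' i - h i)]) ->
  X h1 ->
  (forall h, ppoint h -> X h -> hpeval p h != 0 -> P h) ->
  for_general tt1 (fun h => ppoint h /\ X h) P.
Proof.
move=> ph ph1 Xlin Xh1 XP.
exists (fun h => hpoint tt1 h /\ hpeval p h = 0); split.
- exact: zclosed_zeros (homog_multihomog ph).
- move=> W [S Sh WE] XW h [hpt Xh]; apply/WE; split=> // q qS.
  have [i _ hi] := hpt tt.
  pose l t : {ffun I -> F} := [ffun i => h i + t * (h1 i - h i)].
  have pl j : polyfun (fun t => l t j).
    have := polyfunD (polyfunC (h j)) (polyfunM (polyfun_id F) (polyfunC (h1 j - h j))).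
    by apply: polyfun_ext => t; rewrite ffunE.
  have phl r : polyfun (fun t => hpeval r (l t)) by apply: polyfun_meval => j.
  have l0 : l 0 = h by apply/ffunP => j; rewrite ffunE mul0r addr0.
  have l1 : l 1 = h1 by apply/ffunP => j; rewrite ffunE mul1r addrC subrK.
  (* The line may pass through the zero vector, which is not a point; the factor [l t i] discards
     such [t]. *)
  case: (@polyfun_mul0 F (fun t => l t i * hpeval p (l t)) (fun t => hpeval q (l t))).
  + exact: polyfunM.
  + exact: phl.
  + move=> t; have [lti|lti] := eqVneq (l t i) 0; first by rewrite lti !mul0r.
    have [plt|plt] := eqVneq (hpeval p (l t)) 0; first by rewrite plt mulr0 mul0r.
    suff /WE[_ Sl] : W (l t) by rewrite (Sl q qS) mulr0.
    apply: XW => [|[_ /eqP]]; last by rewrite (negbTE plt).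
    by split; [case; exists i|apply: Xlin].
  + move=> lp; case: (@polyfun_mul0 F (fun t => l t i) (fun t => hpeval p (l t))) => //.
    * by move=> li; have := li 0; rewrite l0 => /eqP; rewrite (negbTE hi).
    * by move=> pl0; have := pl0 1; rewrite l1 => /eqP; rewrite (negbTE ph1).
  + by move=> /(_ 0); rewrite l0.
move=> h [hpt Xh] Zh; apply: XP => //; apply/eqP => ph0; exact: Zh.
Qed.

End ProjectiveSpace.

(** * General tuples of points and adapted frames *)

Section GeneralPoints.
Variables (F : numFieldType) (r : nat) (n d : 'I_r.+1 -> nat).
Hypothesis d_gt0 : forall i, (0 < d i)%N.
Hypothesis n_ge : forall i, (n ord0 <= n i)%N.
Local Notation V := (svvar n).
Local Notation mon := (svmon n d).
Local Notation N := (n ord0).+1.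
Local Notation wid i := (widen_ord (n_ge i : (N <= (n i).+1)%N)).
Local Notation hblocks := (hpoint (fun v : V => tag v)).
Implicit Types (x y z : 'I_N -> {ffun V -> F}) (p : {ffun 'I_N * mon -> F}).

Definition lowvar i (l : 'I_N) : V :=
  svx (wid i l).

Definition corner x i : 'M[F]_N := \matrix_(k, l) x k (lowvar i l).

(** The first [N] columns of [g i] are the points and the others are basis vectors: the matrix is
    block triangular, with the transpose of [corner x i] and an identity on the diagonal. *)
Lemma frame_exists x : (forall i, \det (corner x i) != 0) ->
  exists2 g : forall i, 'M[F]_((n i).+1), forall i, g i \in unitmx &
    forall k : 'I_N, blockact g (coordpt F n k) = x k.
Proof.
move=> detN0; pose g i : 'M[F]_((n i).+1) :=
  \matrix_(a, b) if insub (b : nat) is Some k then x k (svx a) else (a == b)%:R.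
have gE i (u : 'I_(n i).+1 -> F) a : \sum_b u b * g i a b =
    \sum_(k : 'I_N) u (wid i k) * x k (svx a)
    + (if (a < N)%N then 0 else u a).
  rewrite (bigID (fun b : 'I_(n i).+1 => (b < N)%N)) /=; congr (_ + _).
    rewrite (big_ord_narrow (n_ge i : (N <= (n i).+1)%N)) /=.
    by apply: eq_bigr => k _; rewrite mxE /= valK.
  rewrite (eq_bigr (fun b => u b * (a == b)%:R)) => [|b bN]; last first.
    by rewrite mxE insubN.
  case: ifPn => aN.
    rewrite big1 // => b bN; case: eqP => [ab|]; rewrite ?mulr0 //.
    by rewrite -ab aN in bN.
  rewrite (bigD1 a) //= eqxx mulr1 big1 ?addr0 // => b /andP[_ /negbTE ba].
  by rewrite eq_sym ba mulr0.
exists g => [i|k]; last first.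
  apply/ffunP => -[i a]; rewrite ffunE /=.
  under eq_bigr do rewrite mulrC; rewrite gE (bigD1 k) //= ffunE /svpos /= eqxx mul1r.
  rewrite big1 ?addr0 => [|k' kk']; last first.
    have /negbTE kN : k' != k :> nat by exact: kk'.
    by rewrite ffunE /svpos /= kN mul0r.
  rewrite ffunE /svpos /=; case: ifP => aN; rewrite ?addr0 //.
  case: eqP => [ak|]; rewrite ?addr0 //.
  by move: aN; rewrite ak ltn_ord.
rewrite -unitmx_tr -row_free_unit; apply: inj_row_free => v vg0.
have vg a : \sum_b v 0 b * g i a b = 0.
  have /matrixP/(_ 0 a) := vg0; rewrite !mxE => E; rewrite -[RHS]E.
  by apply: eq_bigr => b _; rewrite !mxE.
pose u : 'rV_N := \row_k v 0 (wid i k).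
have u0 : u = 0.
  have cU : corner x i \in unitmx by rewrite unitmxE unitfE.
  apply: (can_inj (mulmxK cU)); rewrite mul0mx; apply/matrixP => i1 l.
  have := vg (wid i l).
  rewrite gE /= ltn_ord addr0 => E; rewrite mxE [RHS]mxE -[RHS]E.
  by apply: eq_bigr => k _; rewrite !mxE.
apply/matrixP => i1 b; rewrite (ord1 i1) [RHS]mxE.
have vlow k : v 0 (wid i k) = 0.
  by have /matrixP/(_ 0 k) := u0; rewrite !mxE.
have [bN|bN] := ltnP b N.
  by rewrite -(vlow (Ordinal bN)); congr (v 0 _); apply/val_inj.
have := vg b; rewrite gE big1 => [|k _]; last by rewrite vlow mul0r.
by rewrite add0r ltnNge bN.
Qed.

(** Powers of the coordinates of index 0 that complete one variable of block [i] to multidegree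
    [d]. *)
Definition restexp i (v : V) : nat :=
  if svpos v == 0%N then (d (tag v) - (tag v == i))%N else 0%N.

Lemma point_mon (u : V) : exists e : mon, forall v,
  svexp e v = ((v == u) + restexp (tag u) v)%N.
Proof.
apply: (@svmon_exists _ _ _ (fun v : V => (v == u) + restexp (tag u) v)%N) => i.
rewrite big_split /= -[RHS](@subnKC (i == tag u)); last by case: eqP.
congr (_ + _)%N.
  case: u => j l /=; case: eqP => [->|ij].
    rewrite (bigD1 l) //= eqxx big1 // => m /negbTE ml.
    by rewrite /svx eq_Tagged /= ml.
  by rewrite big1 // => m _; apply/eqP; rewrite eqb0; apply/eqP => -[].
by rewrite big_ord_recl /= big1 ?addn0.
Qed.

(** The monomials of [point_mon] recover the coordinates of each factor up to a common scalar [wt].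
    So the determinants multiplied in [Q] are those of the corners, with row [k] scaled by
    [c k * wt (x k) i]. *)
Lemma general_points : exists Q : {mpoly F[#|{: 'I_N * mon}|]},
  [/\ multihomog (fun u : 'I_N * mon => u.1) Q,
      forall p x, (forall k, proj_eq [ffun e => p (k, e)] (svmap d (x k))) ->
        hpeval Q p != 0 -> forall i, \det (corner x i) != 0
    & exists y, forall c : 'I_N -> F, (forall k, c k != 0) ->
        hpeval Q [ffun u => c u.1 * svmap d (y u.1) u.2] != 0].
Proof.
have [ee eeE] := fin_all_exists point_mon.
pose wt (x : {ffun V -> F}) i : F :=
  \prod_v x v ^+ restexp i v.
have svee (x : {ffun V -> F}) u : svmap d x (ee u) = x u * wt x (tag u).
  rewrite svmapE; under eq_bigr do rewrite eeE exprD.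
  rewrite big_split /=; congr (_ * _).
  rewrite (bigD1 u) //= eqxx expr1 big1 ?mulr1 // => v /negbTE->.
  by rewrite expr0.
pose U : finType := ('I_N * mon)%type.
pose X k i l : {mpoly F[#|U|]} := 'X_(enum_rank ((k, ee (lowvar i l)) : U)).
pose Q : {mpoly F[#|U|]} := \prod_i \det (\matrix_(k, l) X k i l).
pose PM p i : 'M[F]_N := \matrix_(k, l) p (k, ee (lowvar i l)).
have QE p : hpeval Q p = \prod_i \det (PM p i).
  rewrite /hpeval rmorph_prod; apply: eq_bigr => i _ /=.
  rewrite -det_map_mx; congr (\det _); apply/matrixP => k l.
  by rewrite !mxE /= mevalXU enum_rankK.
exists Q; split.
- apply: multideg_homog; apply: multideg_prod => i.
  apply: (@multideg_ext _ _ _ _ (fun=> 1%N)) => //.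
  apply: multideg_sum => s _.
  set pr := \prod_k _; suff pr_deg : multideg (fun u : 'I_N * mon => u.1) (fun=> 1%N) pr.
    by case: (perm.odd_perm s); rewrite ?expr0 ?mul1r // expr1 mulN1r -scaleN1r;
      apply: multidegZ.
  apply: (@multideg_ext _ _ _ _ (fun k => \sum_k' (k' == k) )%N).
    by move=> k; rewrite (bigD1 k) //= eqxx big1 // => k' /negbTE->.
  by apply: multideg_prod => k; rewrite mxE; apply: multideg_var.
- move=> p x px; rewrite QE => /prodf_neq0 detN0 i; have := detN0 i isT.
  have /fin_all_exists[c cP] : forall k, exists c, forall e, p (k, e) = c * svmap d (x k) e.
    by move=> k; have [c _ cE] := px k; exists c => e; rewrite -cE ffunE.
  have -> : PM p i = diag_mx (\row_k (c k * wt (x k) i)) *m corner x i.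
    apply/matrixP => k l; rewrite mul_diag_mx !mxE cP svee.
    by rewrite mulrA mulrAC.
  by rewrite det_mulmx mulf_eq0 negb_or => /andP[].
(* The ones at index 0 keep every [wt] nonzero; those at index [k] make each corner lower triangular
   with unit diagonal. *)
exists (fun k : 'I_N => [ffun v : V => ((svpos v == 0%N) || (svpos v == k))%:R]) => c cN0.
rewrite QE; apply/prodf_neq0 => i _; rewrite det_trig; last first.
  apply/is_trig_mxP => k l kl; rewrite mxE ffunE /= svee ffunE /svpos /=.
  by rewrite gtn_eqF ?(leq_ltn_trans _ kl) // gtn_eqF // mul0r mulr0.
apply/prodf_neq0 => k _; rewrite mxE ffunE /= svee ffunE /svpos /= eqxx orbT mul1r.
rewrite mulf_neq0 //; apply/prodf_neq0 => v _; rewrite ffunE.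
rewrite /restexp /svpos; case: (nat_of_ord (tagged v) == 0%N).
  by rewrite expr1n oner_neq0.
by rewrite expr0 oner_neq0.
Qed.

(** Density is tested on a curve in the product of varieties: the [svmap] image of lines joining
    representatives of the given points to the tuple [y], where [Q] is nonzero. The scalars [c k]
    make it start at [p]. *)
Lemma for_general_points (P : {ffun 'I_N * mon -> F} -> Prop) :
  (forall p, (forall k, SV [ffun e => p (k, e)]) ->
     (forall x, (forall k, proj_eq [ffun e => p (k, e)] (svmap d (x k))) ->
        forall i, \det (corner x i) != 0) -> P p) ->
  for_general (fun u : 'I_N * mon => u.1) (fun p => forall k, SV [ffun e => p (k, e)]) P.
Proof.
move=> PP; have [Q [Qh Qdet [y yQ]]] := general_points.
exists (fun p => hpoint (fun u : 'I_N * mon => u.1) p /\ hpeval Q p = 0); split.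
- exact: zclosed_zeros.
- move=> W [S Sh WE] XW p Xp.
  have hp : hpoint (fun u : 'I_N * mon => u.1) p.
    move=> k; have [x hx [c c0 pE]] := Xp k; have [e xe] := svmap_neq0 d hx.
    by exists (k, e); have := pE e; rewrite //= ffunE => ->; rewrite mulf_neq0.
  have /fin_all_exists[xc xcP] : forall k, exists xc : {ffun V -> F} * F,
      xc.2 != 0 /\ forall e, p (k, e) = xc.2 * svmap d xc.1 e.
    move=> k; have [x _ [c c0 pE]] := Xp k; exists (x, c); split=> // e.
    by rewrite -pE ffunE.
  pose c k := (xc k).2; pose x k := (xc k).1.
  have c0 k : c k != 0 by case: (xcP k).
  pose xt k t := moved (x k) [ffun v => y k v - x k v] t.
  pose pt t : {ffun 'I_N * mon -> F} := [ffun u => c u.1 * svmap d (xt u.1 t) u.2].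
  have ppt u : polyfun (fun t => pt t u).
    have: polyfun (fun t => c u.1 * \prod_v xt u.1 t v ^+ svexp u.2 v).
      apply: polyfunM; first exact: polyfunC.
      apply: polyfun_prod => v; apply: polyfunX.
      have := polyfunD (polyfunC (x u.1 v))
        (polyfunM (polyfun_id F) (polyfunC ([ffun v => y u.1 v - x u.1 v] v))).
      by apply: polyfun_ext => t; rewrite [in RHS]ffunE.
    by apply: polyfun_ext => t; rewrite [in RHS]ffunE svmapE.
  have phpt q : polyfun (fun t => hpeval q (pt t)) by apply: polyfun_meval => i.
  have pt0 : pt 0 = p.
    apply/ffunP => -[k e]; rewrite ffunE /= (proj2 (xcP k)); congr (_ * svmap d _ e).
    by apply/ffunP => v; rewrite ffunE mul0r addr0.
  have pt1 : hpeval Q (pt 1) != 0.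
    have -> : pt 1 = [ffun u => c u.1 * svmap d (y u.1) u.2]; last exact: yQ.
    apply/ffunP => u; rewrite [LHS]ffunE [RHS]ffunE; congr (_ * svmap d _ _).
    by apply/ffunP => v; rewrite !ffunE mul1r addrC subrK.
  apply/WE; split=> // q qS.
  case: (@polyfun_mul0 F (fun t => hpeval Q (pt t)) (fun t => hpeval q (pt t))) => //.
  + move=> t; have [->|Qt] := eqVneq (hpeval Q (pt t)) 0; first by rewrite mul0r.
    suff /WE[_ Sl] : W (pt t) by rewrite (Sl q qS) mulr0.
    apply: XW => [k|[_ /eqP]]; last by rewrite (negbTE Qt).
    have ptE k' : proj_eq [ffun e => pt t (k', e)] (svmap d (xt k' t)).
      by exists (c k') => // e; rewrite [LHS]ffunE [LHS]ffunE.
    (* An invertible corner has no zero row, so [xt k t] is nonzero in every factor and does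
       represent a point. *)
    exists (xt k t) => //; have detN0 := Qdet _ _ ptE Qt.
    move=> i; have [l xl] : exists l, xt k t (lowvar i l) != 0.
      apply/existsP; have := detN0 i; apply: contraNT; rewrite negb_exists => /forallP x0.
      rewrite (expand_det_row _ k) big1 // => l _; rewrite mxE.
      by have := x0 l; rewrite negbK => /eqP->; rewrite mul0r.
    by exists (lowvar i l).
  + by move=> /(_ 1) /eqP; rewrite (negbTE pt1).
  by move=> /(_ 0); rewrite pt0.
move=> p Xp Zp; apply: PP => // x px i; apply: (Qdet _ _ px).
apply/eqP => Q0; apply: Zp; split=> // k.
have [x' hx [c c0 pE]] := Xp k; have [e xe] := svmap_neq0 d hx.
by exists (k, e); have := pE e; rewrite //= ffunE => ->; rewrite mulf_neq0.
Qed.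

End GeneralPoints.

(** * The contact locus of a general hyperplane *)

Lemma bigminn_le (J : eqType) (s : seq J) (f : J -> nat) (m : nat) j :
  j \in s -> (\big[minn/m]_(i <- s) f i <= f j)%N.
Proof.
elim: s => // i s IHs; rewrite inE big_cons geq_min => /orP[/eqP->|/IHs->].
  by rewrite leqnn.
by rewrite orbT.
Qed.

Lemma bigminn_attained (J : Type) (s : seq J) (f : J -> nat) j0 :
  exists j, \big[minn/f j0]_(i <- s) f i = f j.
Proof.
elim: s => [|i s [j IHs]]; first by exists j0; rewrite big_nil.
by rewrite big_cons IHs /minn; case: ifP => _; [exists i|exists j].
Qed.

Section Main.
Variables (F : numFieldType) (r : nat) (n d : 'I_r.+1 -> nat).
Local Notation mon := (svmon n d).
Local Notation D := (\big[minn/d ord0]_i d i).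
Local Notation N := (n ord0).+1.
Local Notation hblocks := (hpoint (fun v : svvar n => tag v)).

(** Order [s] becomes multiplicity [s.+1]: the spaces spanning T give multiplicity [D], and tangency
    gives multiplicity 2. *)
Lemma sv_osculating_mult s (w : {ffun mon -> F}) T : sv_osculating s w T ->
  exists x : {ffun svvar n -> F}, [/\ hblocks x, proj_eq w (svmap d x) &
    forall h, hyperplane_contains h T <-> mult_ge s.+1 h x].
Proof.
case=> phi [j [x [x1 wx phiE]]] ->; exists x; split=> // [i|h].
  by exists (svx (j i)); rewrite // x1 oner_neq0.
exact: hyperplane_osculatingP.
Qed.

(** At a point of tangency, the factors are proportional to those of some [x m], so it is one of the
    given points; a finite set contains no positive dimensional subvariety. *)
Lemma tangent_general_hyperplane (p : {ffun 'I_N * mon -> F})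
    (T : 'I_N -> {vspace {ffun mon -> F^o}}) (n_ge : forall i, (n ord0 <= n i)%N) :
  (forall i, 0 < d i)%N ->
  (forall k, sv_osculating D.-1 [ffun e => p (k, e)] (T k)) ->
  (forall x, (forall k, proj_eq [ffun e => p (k, e)] (svmap d (x k))) ->
     forall i, \det (corner n_ge x i) != 0) ->
  for_general (fun _ : mon => tt)
    (fun h => ppoint h /\ hyperplane_contains h (\sum_k T k)%VS)
    (fun h => ~ exists Y : {ffun mon -> F} -> Prop,
       [/\ subvariety (fun _ : mon => tt) Y, zdim_ge (fun _ : mon => tt) 1 Y,
           forall w, Y w -> SV w & forall w, Y w -> sv_tangent h w]).
Proof.
move=> d_gt0 Tosc pgen.
have D_le i : (D <= d i)%N by apply: bigminn_le; rewrite mem_index_enum.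
have D_att : exists i, D = d i by apply: bigminn_attained.
have D_gt0 : (0 < D)%N by have [i ->] := D_att.
have /fin_all_exists[x xP] := fun k => sv_osculating_mult (Tosc k).
have detN0 : forall i, \det (corner n_ge x i) != 0.
  by apply: pgen => k; case: (xP k).
have [g gU gx] := frame_exists detN0.
have TE h : hyperplane_contains h (\sum_k T k)%VS <->
    forall k : 'I_N, mult_ge D h (blockact g (coordpt F n k)).
  rewrite hyperplane_contains_sum; split=> hT k.
    by rewrite gx -[D]prednK //; have [_ _ <-] := xP k.
  by have [_ _ ->] := xP k; rewrite prednK // -gx.
have [k [P [Phom [h1 Ph1 h1D] PP]]] := generic_hyperplane d_gt0 n_ge D_le D_att gU.
apply: (for_general_linear Phom Ph1).
- move=> h h' t hT h'T u uT.
  rewrite (eq_bigr (fun i => h i * u i + t * (h' i * u i - h i * u i))) => [|i _].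
    by rewrite big_split -big_distrr sumrB /= hT // h'T // subrr mulr0 addr0.
  by rewrite ffunE mulrDl -mulrA mulrBl.
- by apply/TE.
move=> h hpt /TE hD Ph [Y [_ Ydim _ Ytan]].
have hN0 : exists e, h e != 0 by have [e _ he] := hpt tt; exists e.
apply: (@finite_zdim_lt1 _ _ _ (fun k => svmap d (x k)) Y) Ydim => [l|w /Ytan].
  by apply: svmap_neq0; case: (xP l).
case=> T' /sv_osculating_mult[x' [hx' [c c0 wx'] T'P]] /T'P h2.
have [m [a x'E]] := PP h x' hN0 hx' hD Ph h2.
have {x'E}aE v : x' v = a (tag v) * x m v by rewrite -gx.
exists m, (c * \prod_i a i ^+ d i) => [|e]; last first.
  by rewrite wx' (svmap_scale aE) mulrA.
rewrite mulf_neq0 //; have [e] := svmap_neq0 d hx'.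
by rewrite (svmap_scale aE) mulf_eq0 negb_or => /andP[].
Qed.

End Main.

Theorem proposition4p2 (R : realType) (r : nat) (n d : 'I_r.+1 -> nat)
  (n_gt0 : forall i, (0 < n i)%N)
  (d_gt0 : forall i, (0 < d i)%N)
  (n_le : forall i j : 'I_r.+1, (i <= j)%N -> (n i <= n j)%N)
  (sum_d : (3 <= \sum_i d i)%N)
  (min_d : (2 <= \big[minn/d ord0]_i d i)%N) :
  (* general points p_0, ..., p_(n_1) of the Segre-Veronese variety *)
  for_general (fun u : 'I_(n ord0).+1 * svmon n d => u.1)
    (fun p : {ffun 'I_(n ord0).+1 * svmon n d -> R[i]} =>
       forall k, SV [ffun e => p (k, e)])
    (fun p =>
       forall T : 'I_(n ord0).+1 -> {vspace {ffun svmon n d -> (R[i])^o}},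
       (forall k, sv_osculating (\big[minn/d ord0]_i d i).-1
                    [ffun e => p (k, e)] (T k)) ->
       (* a general hyperplane containing the span of the osculating spaces *)
       for_general (fun _ : svmon n d => tt)
         (fun h : {ffun svmon n d -> R[i]} =>
            ppoint h /\ hyperplane_contains h (\sum_k T k)%VS)
         (fun h =>
            ~ exists Y : {ffun svmon n d -> R[i]} -> Prop,
                [/\ subvariety (fun _ : svmon n d => tt) Y,
                    zdim_ge (fun _ : svmon n d => tt) 1 Y,
                    forall w, Y w -> SV w
                  & forall w, Y w -> sv_tangent h w])).
Proof.
have n_ge i : (n ord0 <= n i)%N by apply: n_le; apply: leq0n.
apply: (@for_general_points (R[i] : numFieldType) _ _ _ d_gt0 n_ge) => p _ pgen T Tosc.
exact: tangent_general_hyperplane d_gt0 Tosc pgen.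
Qed.
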